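(* Let $J$ be a general abelian surface with principal polarization $\omega_J$, let $n\ge2$ be an integer, and identify $J^2$ with $J\times\widehat{J}$ by means of the principal polarization. Then Markman's Cayley class $$C_n:=n\bigl(-n\,c_1(\mathcal{P})^2+4n^2\pi_1^*[pt_J]+4\pi_2^*[pt_{\widehat{J}}]\bigr)$$ can also be written as $$C_n=n\bigl(-n\,\omega_\sigma^2+2n^2\omega_1^2+2\omega_2^2\bigr)\qquad(\in B^2(J^2)),$$ and $C_n\in\operatorname{Sing}(Z)$. For any Cartan subalgebra $K\hookrightarrow M_2(\mathbf{Q})$ with eigenvectors $v_\pm=(\alpha_\pm,1)$ such that $\alpha_+\alpha_-=n$ we have $C_n\in B^2_K$. In fact $$(\alpha_+-\alpha_-)^2\,C_n=n\bigl(-\alpha_+\alpha_-\,\omega_K^2+2\alpha_-^2\,\omega_+^2+2\alpha_+^2\,\omega_-^2\bigr)\qquad(\in B^2_K).$$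
   Context: ''General'' means that the Hodge group of $H^1(J,\mathbf{Q})$ is the full symplectic group $\mathrm{Sp}_4$ of the polarization; in particular $\operatorname{End}_{\mathbf{Q}}(J)=\mathbf{Q}$. $\widehat{J}$ is the dual abelian surface, $\mathcal{P}$ is the normalized Poincaré bundle on $J\times\widehat{J}$, $\pi_1,\pi_2$ are the projections of $J\times\widehat J$, and $[pt_J]$, $[pt_{\widehat J}]$ are the classes of a point. The identification $J\times J\to J\times\widehat{J}$ is the identity on the first factor and, on the second, the isomorphism $J\to\widehat{J}$ which on lattices $H_1(J,\mathbf{Z})\to H_1(\widehat{J},\mathbf{Z})$ is $\lambda'\mapsto\omega_J(-,\lambda')$. Choose a basis $dt_1,\dots,dt_4$ of $H^1(J,\mathbf{Q})$ with $\omega_J=dt_1\wedge dt_2+dt_3\wedge dt_4$, put $dx_j=\mathrm{pr}_1^*dt_j$, $dy_j=\mathrm{pr}_2^*dt_j$ with $\mathrm{pr}_i:J^2\to J$ the projections, and $$\omega_1=dx_1\wedge dx_2+dx_3\wedge dx_4,\quad \omega_2=dy_1\wedge dy_2+dy_3\wedge dy_4,\quad \omega_\sigma=dx_1\wedge dy_2-dx_2\wedge dy_1+dx_3\wedge dy_4-dx_4\wedge dy_3 .$$ Let $B^p(J^2)=H^{2p}(J^2,\mathbf{Q})\cap H^{p,p}(J^2)$ and $B^p:=B^p(J^2)\otimes_{\mathbf{Q}}\mathbf{C}$; then $\omega_1,\omega_\sigma,\omega_2$ is a basis of $B^1$ and $\omega_1^2,\omega_1\omega_2,\omega_2^2,\omega_1\omega_\sigma,\omega_2\omega_\sigma,\omega_\sigma^2$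 (cup products) is a basis of $B^2$. A Cartan subalgebra $K$ of $M_2$ is a two-dimensional subalgebra that is diagonalizable over $\mathbf{C}$, determined by a basis of common eigenvectors in $\mathbf{C}^2$. If these are $v_\pm=(\alpha_\pm,\beta_\pm)$, put $$\omega_\pm:=\alpha_\pm^2\omega_1+\alpha_\pm\beta_\pm\omega_\sigma+\beta_\pm^2\omega_2,\qquad \omega_K:=2\alpha_+\alpha_-\omega_1+(\alpha_+\beta_-+\alpha_-\beta_+)\omega_\sigma+2\beta_+\beta_-\omega_2$$ (with $\beta_\pm=1$ in the claim), and $B^2_K:=\mathbf{C}\omega_K^2\oplus\mathbf{C}\omega_+^2\oplus\mathbf{C}\omega_-^2\subset B^2$. $Z\subset\mathbf{P}B^2\cong\mathbf{P}^5$ is the Zariski closure of the union of all planes $\mathbf{P}B^2_K$ with $K$ a Cartan subalgebra of $M_2(\mathbf{C})$; ''$C_n\in\operatorname{Sing}(Z)$'' means that the point of $\mathbf{P}B^2$ defined by $C_n$ is in the singular locus of $Z$. *)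

(* Defs.v *)
From HB Require Import structures.
From mathcomp Require Import all_boot all_order all_algebra all_fingroup.
From mathcomp Require Import boolp reals.
From mathcomp Require Import complex.
From mathcomp Require Import mpoly.

Set Implicit Arguments.
Unset Strict Implicit.
Unset Printing Implicit Defensive.

Import Order.TTheory GRing.Theory Num.Theory.
Local Open Scope ring_scope.

(** For a torus with lattice H_1 = Z^m, H^k(T, F) is the space of alternating
    k-forms on Z^m with values in F.  Such a form is stored by its values
    [w (t_0, ..., t_(k-1))] on k-tuples of basis vectors; the type [kform F k m]
    contains all k-tensors, and cohomology classes are the [alternating] ones. *)

Notation kform F k m := {ffun {ffun 'I_k -> 'I_m} -> F^o}.

Section Forms.
Variables (F : fieldType).

Definition alternating k m (w : kform F k m) : Prop :=
  forall (t : {ffun 'I_k -> 'I_m}) (s : 'S_k),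
    w [ffun i => t (s i)] = (-1) ^+ s * w t.

(* (a /\ b)(v_1, ..., v_(p+q)) =
     1/(p! q!) sum_s sgn(s) a(v_s(1), ..., v_s(p)) b(v_s(p+1), ..., v_s(p+q)),
   so that dx /\ dy (u, v) = dx(u) dy(v) - dx(v) dy(u). *)
Definition wedge p q m (a : kform F p m) (b : kform F q m) : kform F (p + q) m :=
  [ffun t : {ffun 'I_(p + q) -> 'I_m} => ((p`! * q`!)%N%:R)^-1 *
     \sum_(s : 'S_(p + q)) (-1) ^+ s *
        (a [ffun i => t (s (lshift q i))] * b [ffun j => t (s (rshift p j))])].

Definition cup2 m (a b : kform F 2 m) : kform F 4 m := wedge a b.

(* A : 'M_(m', m) is the linear map x |-> A *m x on H_1, from rank m to rank m'. *)
Definition pull k m' m (A : 'M[F]_(m', m)) (w : kform F k m') : kform F k m :=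
  [ffun t : {ffun 'I_k -> 'I_m} => \sum_(u : {ffun 'I_k -> 'I_m'}) w u * \prod_i A (u i) (t i)].

Definition covec m (r : 'rV[F]_m) : kform F 1 m := [ffun t : {ffun 'I_1 -> 'I_m} => r 0 (t ord0)].

Definition form_of_mx m (E : 'M[F]_m) : kform F 2 m :=
  [ffun t : {ffun 'I_2 -> 'I_m} => E (t ord0) (t ord_max)].

Definition pr1 m m' : 'M[F]_(m, m + m') := row_mx 1%:M 0.
Definition pr2 m m' : 'M[F]_(m', m + m') := row_mx 0 1%:M.

End Forms.

Section Span.
Variables (F : fieldType) (W : vectType F).

Definition is_vspan (S : W -> Prop) (U : {vspace W}) : Prop :=
  (forall x, S x -> x \in U) /\
  (forall U' : {vspace W}, (forall x, S x -> x \in U') -> (U <= U')%VS).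

Lemma vspan_exists (S : W -> Prop) : exists U, is_vspan S U.
Proof.
pose Q k := `[< exists U : {vspace W}, (forall x, S x -> x \in U) /\ \dim U = k >].
have exQ : exists k, Q k.
  by exists (\dim (fullv : {vspace W})); apply/asboolP; exists fullv;
    split=> // x _; rewrite memvf.
case: (ex_minnP exQ) => k /asboolP[U [SU dU]] kmin.
exists U; split=> // U' SU'.
have : Q (\dim (U :&: U')%VS).
  apply/asboolP; exists (U :&: U')%VS; split=> // x Sx.
  by rewrite memv_cap SU // SU'.
move/kmin; rewrite -dU => dle.
have /eqP <- : ((U :&: U')%VS == U) by rewrite eqEdim capvSl.
exact: capvSr.
Qed.

Definition vspan (S : W -> Prop) : {vspace W} := projT1 (cid (vspan_exists S)).

Lemma vspanP (S : W -> Prop) : is_vspan S (vspan S).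
Proof. exact: projT2 (cid (vspan_exists S)). Qed.

End Span.

(** Subsets of P(W) are predicates on W, evaluated at nonzero representatives. *)

Section Projective.
Variables (F : fieldType) (W : vectType F).

Definition peval (p : {mpoly F[\dim {:W}]}) (w : W) : F :=
  p.@[fun i => coord (vbasis {:W}) i w].

(* homogeneous elements of the ideal of X *)
Definition in_ideal (X : W -> Prop) (p : {mpoly F[\dim {:W}]}) : Prop :=
  (exists d : nat, p \is d.-homog) /\
  (forall w, w != 0 -> X w -> peval p w = 0).

Definition zclosure (X : W -> Prop) : W -> Prop :=
  fun w => w != 0 /\ forall p, in_ideal X p -> peval p w = 0.

Definition psub (X Y : W -> Prop) : Prop := forall w, X w -> Y w.

Definition zclosed (X : W -> Prop) : Prop :=
  exists I : {mpoly F[\dim {:W}]} -> Prop,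
    (forall p, I p -> exists d : nat, p \is d.-homog) /\
    (forall w, X w <-> w != 0 /\ forall p, I p -> peval p w = 0).

Definition zirreducible (X : W -> Prop) : Prop :=
  [/\ zclosed X, exists w, X w &
   forall Y1 Y2, zclosed Y1 -> zclosed Y2 ->
     (forall w, X w -> Y1 w \/ Y2 w) -> psub X Y1 \/ psub X Y2].

(* the Zariski tangent space of the affine cone over Z at w *)
Definition cone_tangent (Z : W -> Prop) (w : W) : {vspace W} :=
  vspan (fun u : W => forall p, in_ideal Z p ->
    \sum_i peval (mderiv i p) w * coord (vbasis {:W}) i u = 0).

(* X_0 < X_1 < ... < X_d irreducible closed subsets of Z through [w]; the local
   dimension of Z at [w] is the supremum of such d *)
Definition local_chain (Z : W -> Prop) (w : W) (d : nat) : Prop :=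
  exists X : nat -> W -> Prop,
    (forall i, (i <= d)%N -> [/\ zirreducible (X i), X i w & psub (X i) Z]) /\
    (forall i, (i < d)%N -> psub (X i) (X i.+1) /\ ~ psub (X i.+1) (X i)).

(* dim T_[w] Z > dim_[w] Z, where dim T_[w] Z is one less than for the cone *)
Definition singular_point (Z : W -> Prop) (w : W) : Prop :=
  Z w /\ forall d, local_chain Z w d -> (d < (\dim (cone_tangent Z w)).-1)%N.

End Projective.

Section Tori.
Variable R : realType.
Local Notation C := R[i].

Definition toC m n (A : 'M[R]_(m, n)) : 'M[C]_(m, n) :=
  map_mx (real_complex R) A.

(* the torus R^m / Z^m, where R^m = H_1 (x) R carries the complex structure
   [cplx] *)
Record ctorus (m : nat) := CTorus {
  cplx :> 'M[R]_m;
  cplx_sqr : cplx *m cplx = - 1%:M }.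

Lemma prodT_subproof m m' (T : ctorus m) (T' : ctorus m') :
  block_mx (cplx T) 0 0 (cplx T') *m block_mx (cplx T) 0 0 (cplx T') = - 1%:M.
Proof.
rewrite mulmx_block !mulmx0 !mul0mx !addr0 !add0r !cplx_sqr.
by rewrite [in RHS]scalar_mx_block opp_block_mx !oppr0.
Qed.

Definition prodT m m' (T : ctorus m) (T' : ctorus m') : ctorus (m + m') :=
  CTorus (prodT_subproof T T').

Lemma dualT_subproof m (T : ctorus m) :
  (- (cplx T)^T) *m (- (cplx T)^T) = - 1%:M.
Proof.
by rewrite mulmxN mulNmx opprK -trmx_mul cplx_sqr linearN /= trmx1.
Qed.

(* The dual torus Pic^0(T) = Hom(H_1, R) / Hom(H_1, Z), in the dual basis.  It is
   the quotient of the space of C-antilinear functionals l on (R^m, cplx), with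
   l determined by f = Im l; since (i l)(v) = l(- i v), multiplication by i sends
   f to f o (- cplx). *)
Definition dualT m (T : ctorus m) : ctorus m := CTorus (dualT_subproof T).

(* z in C^* acts on H_1 (x) R by complex scalar multiplication *)
Definition hodge_mx m (T : ctorus m) (z : C) : 'M[C]_m :=
  toC ((complex.Re z)%:M + complex.Im z *: cplx T).

(* H^(p,q) is the part of H^(p+q)(T, C) where the induced action of z is
   z^p (conj z)^q *)
Definition hodge_type m (T : ctorus m) (p q : nat) (k : nat) (w : kform C k m) :
    Prop :=
  forall z : C, pull (hodge_mx T z) w = (z ^+ p * z^* ^+ q) *: w.

Definition rational k m (w : kform C k m) : Prop :=
  forall t, exists r : rat, w t = ratr r.

(* B^p(T) = H^(2p)(T, Q) /\ H^(p,p)(T) *)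
Definition hodge_class m (T : ctorus m) (p : nat) (w : kform C (2 * p) m) : Prop :=
  [/\ alternating w, rational w & hodge_type T p p w].

(* B^p(T) (x) C *)
Definition BC m (T : ctorus m) (p : nat) : {vspace kform C (2 * p) m} :=
  vspan (@hodge_class m T p).

(* The class of a point on a two-dimensional complex torus: the generator of
   H^4(T, Z) that is positive for the complex orientation. *)
Definition point_class (T : ctorus 4) (c : kform C 4 4) : Prop :=
  [/\ alternating c,
      c [ffun i => i] = 1 \/ c [ffun i => i] = -1 &
      forall v w : 'cV[R]_4,
        let frame : 'M[R]_(4, (1 + 1) + (1 + 1)) :=
          row_mx (row_mx v (cplx T *m v)) (row_mx w (cplx T *m w)) in
        0 <= (pull (toC frame) c : kform C 4 4) [ffun i => i]].

Definition intR m n (A : 'M[int]_(m, n)) : 'M[R]_(m, n) := map_mx intr A.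

Definition bil m (E : 'M[R]_m) (x y : 'cV[R]_m) : R := (x^T *m E *m y) 0 0.

Definition eqmodZ (x y : R) : Prop := x - y \is a Num.int.

Definition neron_severi m (T : ctorus m) (E : 'M[int]_m) : Prop :=
  E^T = - E /\ (cplx T)^T *m intR E *m cplx T = intR E.

(* Appell-Humbert: every line bundle is L(H, chi) for a unique Hermitian form H,
   E = Im H, and a unique semicharacter chi.  It is stored as E and the logarithm
   lb_chi, where chi = exp(2 i pi lb_chi) and
   chi(x + y) = chi(x) chi(y) (-1)^E(x, y). *)
Record line_bundle m (T : ctorus m) := LineBundle {
  lb_E : 'M[int]_m;
  lb_chi : 'cV[int]_m -> R;
  lb_NS : neron_severi T lb_E;
  lb_semichar : forall x y : 'cV[int]_m,
    eqmodZ (lb_chi (x + y))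
           (lb_chi x + lb_chi y + bil (intR lb_E) (intR x) (intR y) / 2%:R) }.

Definition c1 m (T : ctorus m) (L : line_bundle T) : kform C 2 m :=
  form_of_mx (toC (intR (lb_E L))).

(* P is a normalized Poincare bundle on T x dual T.
   - The point of the dual torus given by f : Hom(H_1, R) is the line bundle
     with E = 0 and chi(x) = exp(2 i pi f(x)); it must be the restriction of P to
     T x {f}, i.e. the restriction to T x {0} of the translate of P by (0, f).
     Translating L(H, chi) by a multiplies chi by exp(2 i pi E(a, -)).
   - The restriction of P to {0} x dual T must be trivial. *)
Definition normalized_poincare m (T : ctorus m)
    (P : line_bundle (prodT T (dualT T))) : Prop :=
  [/\ ulsubmx (lb_E P) = 0,
      forall (f : 'cV[R]_m) (x : 'cV[int]_m),
        eqmodZ (lb_chi P (col_mx x 0)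
                + bil (intR (lb_E P)) (col_mx 0 f) (intR (col_mx x 0)))
               ((f^T *m intR x) 0 0),
      drsubmx (lb_E P) = 0 &
      forall y : 'cV[int]_m, eqmodZ (lb_chi P (col_mx 0 y)) 0].

Definition principal_polarization m (T : ctorus m) (E : 'M[int]_m) : Prop :=
  [/\ neron_severi T E, E \in unitmx &
      forall v : 'cV[R]_m, v != 0 -> 0 < bil (intR E) (cplx T *m v) v].

(* C-points of the subset of GL_m defined by a set S of polynomials in the
   matrix entries with rational coefficients *)
Definition Qpoints m (S : {mpoly rat[m * m]} -> Prop) (g : 'M[C]_m) : Prop :=
  g \in unitmx /\
  forall p, S p -> (map_mpoly (ratr : rat -> C) p).@[fun i => mxvec g 0 i] = 0.

Definition Qsubgroup m (S : {mpoly rat[m * m]} -> Prop) : Prop :=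
  [/\ Qpoints S 1%:M,
      forall g h, Qpoints S g -> Qpoints S h -> Qpoints S (g *m h) &
      forall g, Qpoints S g -> Qpoints S (invmx g)].

(* C-points of the smallest algebraic subgroup over Q containing the image of
   the unit circle.  g acts on H^1 = row vectors by f |-> f *m g. *)
Definition hodge_group m (T : ctorus m) (g : 'M[C]_m) : Prop :=
  forall S : {mpoly rat[m * m]} -> Prop, Qsubgroup S ->
    (forall z : C, `|z| = 1 -> Qpoints S (hodge_mx T z)) -> Qpoints S g.

Definition general m (T : ctorus m) (E : 'M[int]_m) : Prop :=
  forall g : 'M[C]_m, hodge_group T g <->
    g^T *m toC (intR E) *m g = toC (intR E).

Definition polform m (E : 'M[int]_m) : kform C 2 m := form_of_mx (toC (intR E)).

(* J x J -> J x dual J: identity on the first factor and y |-> E(-, y), whose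
   coordinates in the dual basis are E *m y, on the second *)
Definition ident m (E : 'M[int]_m) : 'M[C]_(m + m, m + m) :=
  toC (intR (block_mx 1%:M 0 0 E)).

Definition cayley_class (J : ctorus 4) (E : 'M[int]_4)
    (P : line_bundle (prodT J (dualT J))) (ptJ ptJhat : kform C 4 4) (n : nat) :
    kform C 4 (4 + 4) :=
  pull (ident E)
    (n%:R *: (- n%:R *: cup2 (c1 P) (c1 P)
              + (4%:R * n%:R ^+ 2) *: pull (pr1 C 4 4) ptJ
              + 4%:R *: pull (pr2 C 4 4) ptJhat)).

Section Basis.
(* row j of dt is the class dt_(j+1) in H^1(J, Q) *)
Variable dt : 'M[rat]_4.

Definition dtC (j : 'I_4) : kform C 1 4 := covec (map_mx ratr (row j dt)).
Definition dx (j : nat) : kform C 1 (4 + 4) := pull (pr1 C 4 4) (dtC (inord j.-1)).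
Definition dy (j : nat) : kform C 1 (4 + 4) := pull (pr2 C 4 4) (dtC (inord j.-1)).

Definition symplectic_basis (E : 'M[int]_4) : Prop :=
  dt \in unitmx /\
  polform E = wedge (dtC (inord 0)) (dtC (inord 1))
              + wedge (dtC (inord 2)) (dtC (inord 3)).

Definition omega1 : kform C 2 (4 + 4) := wedge (dx 1) (dx 2) + wedge (dx 3) (dx 4).
Definition omega2 : kform C 2 (4 + 4) := wedge (dy 1) (dy 2) + wedge (dy 3) (dy 4).
Definition omegaS : kform C 2 (4 + 4) :=
  wedge (dx 1) (dy 2) - wedge (dx 2) (dy 1)
  + wedge (dx 3) (dy 4) - wedge (dx 4) (dy 3).

Definition omegaV (v : 'cV[C]_2) : kform C 2 (4 + 4) :=
  (v 0 0 ^+ 2) *: omega1 + (v 0 0 * v 1 0) *: omegaS + (v 1 0 ^+ 2) *: omega2.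

Definition omegaK (v w : 'cV[C]_2) : kform C 2 (4 + 4) :=
  (2%:R * v 0 0 * w 0 0) *: omega1 + (v 0 0 * w 1 0 + w 0 0 * v 1 0) *: omegaS
  + (2%:R * v 1 0 * w 1 0) *: omega2.

Definition BK (v w : 'cV[C]_2) : {vspace kform C 4 (4 + 4)} :=
  (<[cup2 (omegaK v w) (omegaK v w)]> + <[cup2 (omegaV v) (omegaV v)]>
   + <[cup2 (omegaV w) (omegaV w)]>)%VS.

End Basis.

(* K is a two-dimensional subalgebra of M_2(F), diagonalized over C (via iota) by
   the basis v, w of C^2 *)
Definition cartan_eigenbasis (F : fieldType) (iota : F -> C)
    (K : {vspace 'M[F]_2}) (v w : 'cV[C]_2) : Prop :=
  [/\ \dim K = 2,
      1%:M \in K,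
      forall a b, a \in K -> b \in K -> a *m b \in K,
      row_mx v w \in unitmx &
      forall a, a \in K ->
        (exists l : C, map_mx iota a *m v = l *: v) /\
        (exists l : C, map_mx iota a *m w = l *: w)].

(* Z in P(B^2), the closure of the union of all P(B^2_K) with K in M_2(C) *)
Definition Zlocus (J : ctorus 4) (dt : 'M[rat]_4) :
    subvs_of (BC (prodT J J) 2) -> Prop :=
  zclosure (fun x => exists (K : {vspace 'M[C]_2}) (v w : 'cV[C]_2),
    cartan_eigenbasis id K v w /\ vsval x \in BK dt v w).

End Tori.

(* Main.v *)
Require Import Defs.
From HB Require Import structures.
From mathcomp Require Import all_boot all_order all_algebra all_fingroup.
From mathcomp Require Import boolp reals.
From mathcomp Require Import complex.
From mathcomp Require Import mpoly.
From mathcomp Require Import ring zify.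
Import Order.TTheory GRing.Theory Num.Theory.
Local Open Scope ring_scope.
Set Implicit Arguments.
Unset Strict Implicit.
Unset Printing Implicit Defensive.

(** Three independent observations carry the proof.

    The formula for [C_n].  The normalization conditions determine [c_1] of the
    Poincare bundle ([poincare_mx]); after the identification of the square with
    the product with the dual it becomes [- omega_sigma] ([pull_c1]).  The class
    of a point and half the square of a principal polarization are both
    alternating of top degree, with value [1] or [-1] on the lattice because a
    unimodular Pfaffian is [1] or [-1]; evaluating both on a frame
    [v, I v, w, I w] fixes the sign ([point_class_half_square]).  The
    polarization carries the point class of the dual to that of [J]
    ([dual_point_class_half_square]).

    The planes.  In the basis [x^2, 2xy, y^2] of binary quadratic forms,
    [omega_1, omega_sigma, omega_2] turn [omega_v] into [v^2] and [omega_K] into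
    [2 v w].  The six products of these classes are linearly independent
    ([sq_basis_free]), and the expression of [C_n] in the squares of [omega_K],
    [omega_+], [omega_-] is a polynomial identity in the coefficients
    ([cayley_in_plane]).  Every basis of the plane is the eigenbasis of a Cartan
    algebra ([cartan_of_basis]), so [Z] is the closure of the union of all the
    planes spanned by [(vw)^2, (v^2)^2, (w^2)^2].

    The singularity ([cayley_point_singular]).  The point [C_n] lies on the
    planes given by [(al, 1)], [(ga, 1)] for all [al ga = n] with [al <> ga].
    Every such plane is tangent to [Z] at [C_n], because every line through [C_n]
    in it lies in [Z].  The classes [omega_+^2] so obtained, together with [C_n],
    span all six products ([cayley_point_tangent]), hence the tangent space of
    the cone has dimension at least six.  On the other hand the union of the
    planes has a dense subset parametrized by five variables (the two slopes and
    three coefficients), so that [Z] has dimension at most four.  For chains of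
    irreducible closed sets this is [local_chain_bound]: a chain of length [d]
    gives [d + 1] functions, a linear form and one function cutting each smaller
    member out of the next, whose monomials are linearly independent on the top
    of the chain ([chain_indep]).  Composed with the parametrization they remain
    independent, and there are too many monomials of bounded degree for that
    unless [d + 1 <= 5].

    The argument takes place in the span of the six products; it does not need
    to know that this span is the whole of [B^2]. *)

(** * Alternating forms, wedge products and pullbacks *)

Section AlternatingSums.
Variable R : comNzRingType.

(** The values of a permutation, listed as natural numbers, so that sums over
    the symmetric group can be unrolled by computation. *)
Definition perm_vals n (s : 'S_n) : seq nat := [seq val (s i) | i <- enum 'I_n].

(** A permutation is its first value together with a permutation of the
    remaining ones. *)
Lemma sum_perm_vals n (G : seq nat -> R) :
  \sum_(s : 'S_n.+1) (-1) ^+ s * G (perm_vals s) =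
  \sum_(j < n.+1) (-1) ^+ j *
     \sum_(s : 'S_n) (-1) ^+ s * G (val j :: map (bump j) (perm_vals s)).
Proof.
pose h (js : 'I_n.+1 * 'S_n) := lift_perm ord0 js.1 js.2.
have h_inj : injective h.
  move=> [j s] [j' s'] /permP E; have := E ord0; rewrite !lift_perm_id /= => ejj.
  rewrite -ejj in E *; congr (_, _); apply/permP => k.
  by have := E (lift ord0 k); rewrite !lift_perm_lift => /lift_inj.
have h_bij : bijective h.
  by apply: inj_card_bij; rewrite // card_prod !card_Sn card_ord factS.
rewrite (reindex h (onW_bij _ h_bij)).
rewrite -(pair_bigA _ (fun j s => (-1) ^+ lift_perm ord0 j s *
  G (perm_vals (lift_perm ord0 j s)))) /=.
apply: eq_bigr => j _; rewrite mulr_sumr; apply: eq_bigr => s _.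
rewrite odd_lift_perm /= mulrA signr_addb signr_odd; congr (_ * G _).
rewrite /perm_vals enum_ordSl /= lift_perm_id; congr (_ :: _).
by rewrite -!map_comp; apply: eq_map => k /=; rewrite lift_perm_lift.
Qed.

(** The signed sum over the symmetric group, by recursion on the first value:
    [bump j] renumbers the values that remain after [j] is used. *)
Fixpoint alternating_sum n (G : seq nat -> R) : R :=
  if n is n'.+1 then
    \sum_(j < n) (-1) ^+ j *
       alternating_sum n' (fun l => G (val j :: map (bump j) l))
  else G [::].

Lemma sum_perm_vals_alternating n (G : seq nat -> R) :
  \sum_(s : 'S_n) (-1) ^+ s * G (perm_vals s) = alternating_sum n G.
Proof.
elim: n G => [|n IH] G.
  rewrite (big_pred1 1%g) => [|s]; last by apply/esym/eqP/permP => -[].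
  by rewrite odd_perm1 expr0 mul1r /perm_vals enum_ord0.
rewrite sum_perm_vals; apply: eq_bigr => j _; congr (_ * _).
exact: (IH (fun l => G (val j :: map (bump j) l))).
Qed.

Lemma sum_S4 (G : seq nat -> R) :
  \sum_(s : 'S_4) (-1) ^+ s * G (perm_vals s) =
    G [:: 0; 1; 2; 3] - G [:: 0; 1; 3; 2] - G [:: 0; 2; 1; 3]
  + G [:: 0; 2; 3; 1] + G [:: 0; 3; 1; 2] - G [:: 0; 3; 2; 1]
  - G [:: 1; 0; 2; 3] + G [:: 1; 0; 3; 2] + G [:: 1; 2; 0; 3]
  - G [:: 1; 2; 3; 0] - G [:: 1; 3; 0; 2] + G [:: 1; 3; 2; 0]
  + G [:: 2; 0; 1; 3] - G [:: 2; 0; 3; 1] - G [:: 2; 1; 0; 3]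
  + G [:: 2; 1; 3; 0] + G [:: 2; 3; 0; 1] - G [:: 2; 3; 1; 0]
  - G [:: 3; 0; 1; 2] + G [:: 3; 0; 2; 1] + G [:: 3; 1; 0; 2]
  - G [:: 3; 1; 2; 0] - G [:: 3; 2; 0; 1] + G [:: 3; 2; 1; 0].
Proof.
rewrite sum_perm_vals_alternating /alternating_sum /=.
rewrite !big_ord_recl !big_ord0 /= /bump /=; ring.
Qed.
End AlternatingSums.

Section FormAlgebra.
Variable F : fieldType.

(* The coefficients of forms lie in the regular module [F^o]; the next lemmas
   read sums, multiples and products of forms back in the field [F]. *)
Lemma formP k m (a b : kform F k m) : (forall t, a t = b t :> F) -> a = b.
Proof. by move=> ab; apply/ffunP. Qed.

Lemma formDE k m (a b : kform F k m) t : ((a + b) t : F) = (a t : F) + (b t : F).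
Proof. by rewrite ffunE. Qed.

Lemma form0E k m t : ((0 : kform F k m) t : F) = 0.
Proof. by rewrite ffunE. Qed.

Lemma formZE k m c (a : kform F k m) t : ((c *: a) t : F) = c * (a t : F).
Proof. by rewrite ffunE. Qed.

Lemma wedgeE p q m (a : kform F p m) (b : kform F q m) t :
  (wedge a b t : F) = ((p`! * q`!)%N%:R)^-1 *
     \sum_(s : 'S_(p + q)) (-1) ^+ s *
        ((a [ffun i => t (s (lshift q i))] : F) *
         (b [ffun j => t (s (rshift p j))] : F)).
Proof. by rewrite ffunE. Qed.

Lemma pullE k m' m (A : 'M[F]_(m', m)) (w : kform F k m') t :
  (pull A w t : F) = \sum_u (w u : F) * \prod_i A (u i) (t i).
Proof. by rewrite ffunE. Qed.

Lemma form_of_mxE m (E : 'M[F]_m) t : (form_of_mx E t : F) = E (t ord0) (t ord_max).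
Proof. by rewrite ffunE. Qed.

Lemma covecE m (r : 'rV[F]_m) t : (covec r t : F) = r 0 (t ord0).
Proof. by rewrite ffunE. Qed.

Lemma wedgeDl p q m (a b : kform F p m) (c : kform F q m) :
  wedge (a + b) c = wedge a c + wedge b c.
Proof.
apply: formP => t; rewrite formDE !wedgeE -mulrDr -big_split /=; congr (_ * _).
by apply: eq_bigr => s _; rewrite formDE mulrDl mulrDr.
Qed.

Lemma wedgeDr p q m (a : kform F p m) (b c : kform F q m) :
  wedge a (b + c) = wedge a b + wedge a c.
Proof.
apply: formP => t; rewrite formDE !wedgeE -mulrDr -big_split /=; congr (_ * _).
by apply: eq_bigr => s _; rewrite formDE !mulrDr.
Qed.

Lemma wedgeZl p q m k (a : kform F p m) (c : kform F q m) :
  wedge (k *: a) c = k *: wedge a c.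
Proof.
apply: formP => t; rewrite formZE !wedgeE [RHS]mulrCA [X in _ = _ * X]mulr_sumr.
congr (_ * _).
by apply: eq_bigr => s _; rewrite formZE -mulrA [RHS]mulrCA.
Qed.

Lemma wedgeZr p q m k (a : kform F p m) (c : kform F q m) :
  wedge a (k *: c) = k *: wedge a c.
Proof.
apply: formP => t; rewrite formZE !wedgeE [RHS]mulrCA [X in _ = _ * X]mulr_sumr.
congr (_ * _).
by apply: eq_bigr => s _; rewrite formZE [RHS]mulrCA; congr (_ * _); rewrite mulrCA.
Qed.

Lemma pullD k m' m (A : 'M[F]_(m', m)) (a b : kform F k m') :
  pull A (a + b) = pull A a + pull A b.
Proof.
apply: formP => t; rewrite formDE !pullE -big_split; apply: eq_bigr => u _.
by rewrite formDE mulrDl.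
Qed.

Lemma pullZ k m' m (A : 'M[F]_(m', m)) c (a : kform F k m') :
  pull A (c *: a) = c *: pull A a.
Proof.
apply: formP => t; rewrite formZE !pullE [RHS]mulr_sumr; apply: eq_bigr => u _.
by rewrite formZE -mulrA.
Qed.

Lemma pull0 k m' m (A : 'M[F]_(m', m)) : pull A (0 : kform F k m') = 0.
Proof. by rewrite -[0 in LHS](scale0r 0) pullZ scale0r. Qed.

Lemma pull_sum k m' m (A : 'M[F]_(m', m)) (I : finType) (g : I -> kform F k m') :
  pull A (\sum_i g i) = \sum_i pull A (g i).
Proof. exact: (big_morph (pull A) (pullD A) (pull0 _ A)). Qed.

Lemma pull_comp k m1 m2 m3 (A : 'M[F]_(m2, m3)) (B : 'M[F]_(m1, m2))
    (w : kform F k m1) : pull A (pull B w) = pull (B *m A) w.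
Proof.
apply: formP => t; rewrite !pullE.
under eq_bigr do rewrite pullE mulr_suml.
rewrite exchange_big; apply: eq_bigr => u _ /=.
under eq_bigr do rewrite -mulrA.
rewrite -mulr_sumr; congr (_ * _).
under [RHS]eq_bigr do rewrite mxE.
rewrite bigA_distr_bigA; apply: eq_bigr => v _.
by rewrite -big_split.
Qed.

(** A tuple indexed by ['I_(p + q)] is a pair of tuples. *)
Lemma sum_ffun_split (T : finType) p q
    (G : {ffun 'I_p -> T} -> {ffun 'I_q -> T} -> F) :
  \sum_(u : {ffun 'I_(p + q) -> T})
     G [ffun i => u (lshift q i)] [ffun j => u (rshift p j)] =
  \sum_a \sum_b G a b.
Proof.
rewrite pair_bigA /=.
pose h (ab : {ffun 'I_p -> T} * {ffun 'I_q -> T}) : {ffun 'I_(p + q) -> T} :=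
  [ffun k => match split k with inl i => ab.1 i | inr j => ab.2 j end].
have hl ab i : h ab (lshift q i) = ab.1 i.
  by rewrite ffunE (unsplitK (inl i)).
have hr ab j : h ab (rshift p j) = ab.2 j.
  by rewrite ffunE (unsplitK (inr j)).
rewrite (reindex h) /=.
  apply: eq_bigr => ab _; congr G; apply/ffunP => i; rewrite !ffunE.
    by rewrite (unsplitK (inl i)).
  by rewrite (unsplitK (inr i)).
exists (fun u : {ffun 'I_(p + q) -> T} =>
  ([ffun i => u (lshift q i)], [ffun j => u (rshift p j)])) => [[a b] _ | u _].
  by congr (_, _); apply/ffunP => i; rewrite ffunE ?hl ?hr.
apply/ffunP => k; rewrite ffunE -[in RHS](splitK k).
by case: (split k) => i; rewrite /= ffunE.
Qed.

Lemma sum_ffun1 (T : finType) (G : {ffun 'I_1 -> T} -> F) :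
  \sum_u G u = \sum_i G [ffun=> i].
Proof.
rewrite (reindex (fun i : T => [ffun _ : 'I_1 => i])) //.
exists (fun u : {ffun 'I_1 -> T} => u ord0) => [i _|u _]; first by rewrite ffunE.
by apply/ffunP => i; rewrite ffunE (ord1 i).
Qed.

Lemma pull_wedge p q m m' (A : 'M[F]_(m', m)) (a : kform F p m') (b : kform F q m') :
  pull A (wedge a b) = wedge (pull A a) (pull A b).
Proof.
apply: formP => t; rewrite wedgeE pullE.
under eq_bigr do rewrite wedgeE -mulrA mulr_suml.
rewrite -mulr_sumr; congr (_ * _); rewrite exchange_big /=.
apply: eq_bigr => s _; under eq_bigr do rewrite -mulrA.
rewrite -mulr_sumr; congr (_ * _).
(* Permuting the summation index [u] by [s] moves the permutation from the
   arguments of the forms to the columns of [A]. *)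
rewrite (reindex (fun u : {ffun 'I_(p + q) -> 'I_m'} =>
  [ffun i => u (s^-1%g i)])) /=; last first.
  exists (fun u : {ffun 'I_(p + q) -> 'I_m'} => [ffun i => u (s i)]) => u _;
  by apply/ffunP => i; rewrite !ffunE ?permK ?permKV.
pose G (u : {ffun 'I_p -> 'I_m'}) (v : {ffun 'I_q -> 'I_m'}) :=
  (a u * \prod_i A (u i) (t (s (lshift q i)))) *
  (b v * \prod_j A (v j) (t (s (rshift p j)))).
transitivity (\sum_u \sum_v G u v); last first.
  rewrite !pullE big_distrlr /=; apply: eq_bigr => u _; apply: eq_bigr => v _.
  by rewrite /G; congr (_ * _ * (_ * _)); apply: eq_bigr => i _; rewrite ffunE.
rewrite -sum_ffun_split; apply: eq_bigr => u _; rewrite /G.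
rewrite (reindex_inj (@perm_inj _ s)) /= big_split_ord /= mulrACA.
congr (_ * _ * (_ * _)).
- by congr (a _); apply/ffunP => i; rewrite !ffunE permK.
- by apply: eq_bigr => i _; rewrite !ffunE permK.
- by congr (b _); apply/ffunP => i; rewrite !ffunE permK.
- by apply: eq_bigr => i _; rewrite !ffunE permK.
Qed.

Lemma alternatingD k m (a b : kform F k m) :
  alternating a -> alternating b -> alternating (a + b).
Proof. by move=> ha hb t s; rewrite !formDE ha hb mulrDr. Qed.

Lemma alternatingZ k m c (a : kform F k m) :
  alternating a -> alternating (c *: a).
Proof. by move=> ha t s; rewrite !formZE ha mulrCA. Qed.

Lemma wedge_alternating p q m (a : kform F p m) (b : kform F q m) :
  alternating (wedge a b).
Proof.
move=> t s0; rewrite !wedgeE mulrCA; congr (_ * _).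
rewrite [RHS]mulr_sumr (reindex_inj (mulIg s0^-1%g)) /=; apply: eq_bigr => s _.
rewrite [RHS]mulrA; congr (_ * (_ * _)).
- by rewrite odd_permM odd_permV signr_addb mulrC.
- by congr (a _); apply/ffunP => i; rewrite !ffunE permM permKV.
- by congr (b _); apply/ffunP => i; rewrite !ffunE permM permKV.
Qed.

Lemma pull_form_of_mx m m' (A : 'M[F]_(m', m)) (E : 'M[F]_m') :
  pull A (form_of_mx E) = form_of_mx (A^T *m E *m A).
Proof.
apply: formP => t; rewrite pullE form_of_mxE !mxE.
pose G (u v : {ffun 'I_1 -> 'I_m'}) :=
  E (u ord0) (v ord0) * (A (u ord0) (t ord0) * A (v ord0) (t ord_max)).
transitivity (\sum_u \sum_v G u v).
  rewrite -sum_ffun_split; apply: eq_bigr => u _.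
  have e0 : lshift 1 (ord0 : 'I_1) = (ord0 : 'I_2) by apply: val_inj.
  have e1 : rshift 1 (ord0 : 'I_1) = (ord_max : 'I_2) by apply: val_inj.
  have e2 : lift ord0 (ord0 : 'I_1) = (ord_max : 'I_2) by apply: val_inj.
  by rewrite /G form_of_mxE !ffunE big_ord_recl big_ord1 e0 e1 e2.
rewrite sum_ffun1; under eq_bigr do rewrite sum_ffun1.
under [RHS]eq_bigr do rewrite mxE mulr_suml.
rewrite [RHS]exchange_big; apply: eq_bigr => i _; apply: eq_bigr => j _ /=.
rewrite /G !ffunE ?mxE; ring.
Qed.

Lemma pull_covec m m' (A : 'M[F]_(m', m)) (r : 'rV[F]_m') :
  pull A (covec r) = covec (r *m A).
Proof.
apply: formP => t; rewrite pullE covecE !mxE.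
by rewrite sum_ffun1; apply: eq_bigr => i _; rewrite covecE ffunE big_ord1 ffunE.
Qed.

Lemma form_of_mxD m (A B : 'M[F]_m) :
  form_of_mx (A + B) = form_of_mx A + form_of_mx B.
Proof. by apply/ffunP => t; rewrite !ffunE mxE. Qed.

Lemma form_of_mxZ m c (A : 'M[F]_m) : form_of_mx (c *: A) = c *: form_of_mx A.
Proof. by apply/ffunP => t; rewrite !ffunE mxE. Qed.

Lemma form_of_mxN m (A : 'M[F]_m) : form_of_mx (- A) = - form_of_mx A.
Proof. by apply/ffunP => t; rewrite !ffunE mxE. Qed.

End FormAlgebra.

(** * Products of two 2-forms, and forms of top degree *)

Lemma nth_perm_vals n (s : 'S_n) (i : 'I_n) : nth 0 (perm_vals s) i = s i.
Proof. by rewrite /perm_vals (nth_map i) ?size_enum_ord // nth_ord_enum. Qed.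

(** The polarized Pfaffian of two alternating matrices on the four indices
    [x 0, ..., x 3]; for [M = N] it is twice the Pfaffian. *)
Definition polar_pfaffian (R : comNzRingType) m (M N : 'M[R]_m) (x : nat -> 'I_m) : R :=
    M (x 0) (x 1) * N (x 2) (x 3) - M (x 0) (x 2) * N (x 1) (x 3)
  + M (x 0) (x 3) * N (x 1) (x 2) + M (x 1) (x 2) * N (x 0) (x 3)
  - M (x 1) (x 3) * N (x 0) (x 2) + M (x 2) (x 3) * N (x 0) (x 1).

Section CupProduct.
Variable F : numFieldType.

Lemma cup2_form_of_mx m (M N : 'M[F]_m) (t : {ffun 'I_4 -> 'I_m}) :
  M^T = - M -> N^T = - N ->
  (cup2 (form_of_mx M) (form_of_mx N) t : F) =
  polar_pfaffian M N (fun k => t (inord k)).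
Proof.
move=> skewM skewN; pose x k : 'I_m := t (inord k).
pose G l := M (x (nth 0 l 0)) (x (nth 0 l 1)) * N (x (nth 0 l 2)) (x (nth 0 l 3)).
have xE (s : 'S_4) (i : 'I_4) : x (nth 0 (perm_vals s) i) = t (s i).
  by rewrite nth_perm_vals /x inord_val.
etransitivity; first exact: (wedgeE (form_of_mx M) (form_of_mx N) t).
rewrite (eq_bigr (fun s : 'S_4 => (-1) ^+ s * G (perm_vals s))); last first.
  move=> s _; rewrite !form_of_mxE !ffunE /G.
  by rewrite -!xE.
rewrite sum_S4 /G /=.
have sM i j : M i j = - M j i by rewrite -[M in LHS]trmxK skewM linearN /= !mxE.
have sN i j : N i j = - N j i by rewrite -[N in LHS]trmxK skewN linearN /= !mxE.
rewrite (sM (x 1) (x 0)) (sM (x 2) (x 0)) (sM (x 3) (x 0)).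
rewrite (sM (x 2) (x 1)) (sM (x 3) (x 1)) (sM (x 3) (x 2)).
rewrite (sN (x 1) (x 0)) (sN (x 2) (x 0)) (sN (x 3) (x 0)).
rewrite (sN (x 2) (x 1)) (sN (x 3) (x 1)) (sN (x 3) (x 2)).
rewrite /polar_pfaffian -/(x _) !factS fact0 !muln1.
by field.
Qed.

(** Forms of top degree: the value on the standard basis determines an
    alternating form. *)
Lemma alternating_top m (a b : kform F m m) : alternating a -> alternating b ->
  a [ffun i => i] = b [ffun i => i] -> a = b.
Proof.
move=> alta altb ab; apply: formP => t.
have [t_inj | /injectivePn] := boolP (injectiveb t).
  have /injectiveP t_inj' := t_inj.
  have -> : t = [ffun i => [ffun i => i] (perm t_inj' i)].
    by apply/ffunP => i; rewrite !ffunE permE.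
  by rewrite alta altb ab.
move=> [i [j nij tij]].
have tE : [ffun k => t (tperm i j k)] = t.
  by apply/ffunP => k; rewrite ffunE; case: tpermP => // ->.
have zero (c : kform F m m) : alternating c -> (c t : F) = 0.
  move=> altc; have := altc t (tperm i j); rewrite tE odd_tperm nij expr1 mulN1r.
  by move/eqP; rewrite -addr_eq0 -mulr2n mulrn_eq0 => /eqP.
by rewrite !zero.
Qed.
End CupProduct.

(** A unimodular alternating form of rank four has Pfaffian [1] or [-1], since
    the determinant is the square of the Pfaffian. *)
Lemma polar_pfaffian_unimodular (E : 'M[int]_4) : E^T = - E -> E \in unitmx ->
  exists e : bool, polar_pfaffian E E inord = 2%:R * (-1) ^+ e.
Proof.
move=> skewE; rewrite unitmxE.
pose pf := E (inord 0) (inord 1) * E (inord 2) (inord 3)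
  - E (inord 0) (inord 2) * E (inord 1) (inord 3)
  + E (inord 0) (inord 3) * E (inord 1) (inord 2).
have pfE : polar_pfaffian E E inord = 2%:R * pf by rewrite /polar_pfaffian /pf; ring.
have sE i j : E i j = - E j i by rewrite -[E in LHS]trmxK skewE linearN /= !mxE.
have dE i : E i i = 0.
  by have := sE i i; lia.
have -> : \det E = pf ^+ 2.
  pose e k j := E (inord k) (inord j).
  pose G l : int :=
    e 0 (nth 0 l 0) * e 1 (nth 0 l 1) * e 2 (nth 0 l 2) * e 3 (nth 0 l 3).
  have prod4 (f : 'I_4 -> int) : \prod_i f i =
      f (inord 0) * f (inord 1) * f (inord 2) * f (inord 3).
    rewrite !big_ord_recl big_ord0 !mulrA mulr1; congr (f _ * f _ * f _ * f _);
    by apply: val_inj; rewrite /= inordK.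
  rewrite /determinant.
  rewrite (eq_bigr (fun s : 'S_4 => (-1) ^+ s * G (perm_vals s))); last first.
    move=> s _; rewrite prod4 /G; congr (_ * (E _ _ * E _ _ * E _ _ * E _ _));
    by rewrite -[X in nth _ _ X](@inordK 3) // nth_perm_vals inord_val.
  rewrite sum_S4 /G /= /e /pf !dE.
  rewrite (sE (inord 1) (inord 0)) (sE (inord 2) (inord 0)) (sE (inord 3) (inord 0)).
  rewrite (sE (inord 2) (inord 1)) (sE (inord 3) (inord 1)) (sE (inord 3) (inord 2)).
  ring.
rewrite unitrX_pos // pfE => /orP[/eqP -> | /eqP ->].
  by exists false.
by exists true.
Qed.

(** * Forms on the square of a torus *)

Section ProductForms.
Variable F : fieldType.

Lemma wedge_covec m (r s : 'rV[F]_m) :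
  wedge (covec r) (covec s) = form_of_mx (r^T *m s - s^T *m r).
Proof.
apply: formP => t; rewrite form_of_mxE wedgeE !factS fact0 !muln1 invr1 mul1r.
pose x k := t (inord k).
pose G l := r 0 (x (nth 0%N l 0)) * s 0 (x (nth 0%N l 1)).
have xE (u : 'S_2) (i : 'I_2) : x (nth 0%N (perm_vals u) i) = t (u i).
  by rewrite nth_perm_vals /x inord_val.
rewrite (eq_bigr (fun u : 'S_2 => (-1) ^+ u * G (perm_vals u))); last first.
  move=> u _; rewrite !covecE !ffunE /G; congr (_ * (r _ _ * s _ _));
  by rewrite -xE.
rewrite sum_perm_vals_alternating /alternating_sum /=.
rewrite !big_ord_recl !big_ord0 /= /bump /= /G /=.
have -> : t ord0 = x 0%N by congr (t _); apply: val_inj; rewrite /= inordK.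
have -> : t ord_max = x 1%N by congr (t _); apply: val_inj; rewrite /= inordK.
rewrite !mxE !big_ord1 !mxE; ring.
Qed.

Lemma form_of_mx_inj m : injective (@form_of_mx F m).
Proof.
move=> A B /ffunP AB; apply/matrixP => i j.
have := AB [ffun k : 'I_2 => if k == ord0 then i else j].
by rewrite !ffunE.
Qed.

(** If [M] is the matrix of [omega] on a torus, [quad_mx M p q r] is that of
    [p omega_1 + q omega_sigma + r omega_2] on its square. *)
Definition quad_mx m (M : 'M[F]_m) (p q r : F) : 'M[F]_(m + m) :=
  block_mx (p *: M) (q *: M) (q *: M) (r *: M).

Lemma quad_mx_skew m (M : 'M[F]_m) p q r :
  M^T = - M -> (quad_mx M p q r)^T = - quad_mx M p q r.
Proof.
by move=> skM; rewrite tr_block_mx !linearZ /= skM !scalerN opp_block_mx.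
Qed.

Lemma pr1_form m (M : 'M[F]_m) :
  pull (pr1 F m m) (form_of_mx M) = form_of_mx (quad_mx M 1 0 0).
Proof.
rewrite pull_form_of_mx; congr form_of_mx; rewrite /pr1 /quad_mx.
rewrite tr_row_mx trmx1 trmx0 mul_col_mx !mul1mx !mul0mx mul_col_row.
by rewrite !mulmx1 !mulmx0 !scale0r scale1r.
Qed.

Lemma pr2_form m (M : 'M[F]_m) :
  pull (pr2 F m m) (form_of_mx M) = form_of_mx (quad_mx M 0 0 1).
Proof.
rewrite pull_form_of_mx; congr form_of_mx; rewrite /pr2 /quad_mx.
rewrite tr_row_mx trmx1 trmx0 mul_col_mx !mul1mx !mul0mx mul_col_row.
by rewrite !mulmx1 !mulmx0 !scale0r scale1r.
Qed.

(** The matrix of [a /\ b + c /\ d]. *)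
Definition hyperbolic_mx m (a b c d : 'rV[F]_m) : 'M[F]_m :=
  (a^T *m b - b^T *m a) + (c^T *m d - d^T *m c).

Lemma wedge_hyperbolic m (a b c d : 'rV[F]_m) :
  wedge (covec a) (covec b) + wedge (covec c) (covec d) =
  form_of_mx (hyperbolic_mx a b c d).
Proof. by rewrite !wedge_covec -form_of_mxD. Qed.

Lemma pull_hyperbolic m m' (A : 'M[F]_(m', m)) (a b c d : 'rV[F]_m') :
  wedge (pull A (covec a)) (pull A (covec b)) +
  wedge (pull A (covec c)) (pull A (covec d)) =
  pull A (form_of_mx (hyperbolic_mx a b c d)).
Proof. by rewrite -!pull_wedge -pullD wedge_hyperbolic. Qed.

(** The mixed class [omega_sigma] of [a /\ b + c /\ d]. *)
Lemma mixed_hyperbolic m (a b c d : 'rV[F]_m) :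
  let x r := pull (pr1 F m m) (covec r) in
  let y r := pull (pr2 F m m) (covec r) in
  wedge (x a) (y b) - wedge (x b) (y a) + wedge (x c) (y d) - wedge (x d) (y c) =
  form_of_mx (quad_mx (hyperbolic_mx a b c d) 0 1 0).
Proof.
move=> x y; rewrite /x /y !pull_covec !wedge_covec -!form_of_mxN -!form_of_mxD.
congr form_of_mx; rewrite /pr1 /pr2 !mul_mx_row !mulmx1 !mulmx0 !tr_row_mx !trmx0.
rewrite !mul_col_mx !mul0mx /quad_mx block_mxEh !scale0r !scale1r.
rewrite !(opp_row_mx, add_row_mx, opp_col_mx, add_col_mx, oppr0, addr0, add0r, sub0r).
rewrite /hyperbolic_mx; congr (row_mx (col_mx _ _) (col_mx _ _)); last exact/esym/addrA.
by rewrite !opprK -addrA [- _ + _]addrC [- (d^T *m c) + _]addrC.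
Qed.

Lemma pull_quad_diag m m' (A : 'M[F]_(m', m)) (M : 'M[F]_m') p q r :
  pull (block_mx A 0 0 A) (form_of_mx (quad_mx M p q r)) =
  form_of_mx (quad_mx (A^T *m M *m A) p q r).
Proof.
rewrite pull_form_of_mx /quad_mx tr_block_mx !trmx0 !mulmx_block.
rewrite !(mulmx0, mul0mx, addr0, add0r).
by rewrite -!(scalemxAl, scalemxAr).
Qed.
End ProductForms.

(** * Chains of irreducible closed sets *)

Section UnivariateZeros.
Variable F : numFieldType.

(* Characteristic 0: the integers are infinitely many roots. *)
Lemma poly_eq0_everywhere (Q : {poly F}) : (forall t, Q.[t] = 0) -> Q = 0.
Proof.
move=> Q0; apply/eqP/negPn/negP => nzQ.
pose rs := [seq (i%:R : F) | i <- iota 0 (size Q)].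
have rQ : all (root Q) rs by apply/allP => x _; apply/rootP.
have urs : uniq rs.
  by rewrite map_inj_uniq ?iota_uniq // => i j /eqP; rewrite eqr_nat => /eqP.
by have := max_poly_roots nzQ rQ urs; rewrite size_map size_iota ltnn.
Qed.

Lemma poly_eq0_generic (Q S : {poly F}) :
  S != 0 -> (forall t, S.[t] != 0 -> Q.[t] = 0) -> Q = 0.
Proof.
move=> nzS Q0; apply/eqP; have : Q * S == 0.
  apply/eqP/poly_eq0_everywhere => t; rewrite hornerM.
  by have [->|/Q0 ->] := eqVneq S.[t] 0; rewrite ?mulr0 ?mul0r.
by rewrite mulf_eq0 (negPf nzS) orbF.
Qed.
End UnivariateZeros.

Section Peval.
Variables (F : fieldType) (W : vectType F).
Notation n := (\dim {:W}).
Implicit Types (p q : {mpoly F[n]}) (w : W).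

Lemma peval_sum (I : finType) (g : I -> {mpoly F[n]}) w :
  peval (\sum_i g i) w = \sum_i peval (g i) w.
Proof. by rewrite /peval raddf_sum. Qed.

Lemma exists_coord_neq0 w : w != 0 -> exists j, coord (vbasis {:W}) j w != 0.
Proof.
move=> nzw; apply/existsP; apply: contraNT nzw; rewrite negb_exists => /forallP H.
rewrite (coord_vbasis (memvf w)) big1 // => j _.
by move/negbNE/eqP: (H j) => ->; rewrite scale0r.
Qed.

Lemma pevalD p q w : peval (p + q) w = peval p w + peval q w.
Proof. exact: mevalD. Qed.

Lemma pevalM p q w : peval (p * q) w = peval p w * peval q w.
Proof. exact: mevalM. Qed.

Lemma pevalZ c p w : peval (c *: p) w = c * peval p w.
Proof. exact: mevalZ. Qed.

Lemma pevalXn p j w : peval (p ^+ j) w = peval p w ^+ j.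
Proof. exact: rmorphXn. Qed.

Lemma peval_homog_scale d p c w :
  p \is d.-homog -> peval p (c *: w) = c ^+ d * peval p w.
Proof.
move=> hp; rewrite /peval !mevalE big_distrr /=; apply: eq_big_seq => m mp.
rewrite mulrCA; congr (_ * _).
rewrite -(dhomog_mf hp mp) /= mdegE -prodrXr -big_split /=.
by apply: eq_bigr => i _; rewrite linearZ /= exprMn.
Qed.
End Peval.

(** The homogeneous components of a polynomial that vanishes on a punctured
    line through the origin vanish on it as well. *)
Lemma peval_component_eq0 (F : numFieldType) (W : vectType F)
    (p : {mpoly F[\dim {:W}]}) (w : W) :
  (forall c, c != 0 -> peval p (c *: w) = 0) ->
  forall d, peval (pihomog mdeg d p) w = 0.
Proof.
move=> p0 d; pose k := maxn (msize p) d.+1.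
pose Q : {poly F} := \poly_(i < k) peval (pihomog mdeg i p) w.
have QE c : Q.[c] = peval p (c *: w).
  transitivity (peval (\sum_(i < k) pihomog mdeg i p) (c *: w)); last first.
    by rewrite -pihomog_partitionE // leq_maxl.
  rewrite peval_sum horner_poly; apply: eq_bigr => i _.
  by rewrite (peval_homog_scale _ _ (pihomogP _ _ _)) mulrC.
have Q0 : Q = 0.
  apply: (@poly_eq0_generic _ _ 'X); first by rewrite polyX_eq0.
  by move=> t; rewrite hornerX QE => /p0.
have := coef_poly k (fun i => peval (pihomog mdeg i p) w) d.
by rewrite -/Q Q0 coef0 leq_max leqnn orbT.
Qed.

Section Irreducible.
Variables (F : numFieldType) (W : vectType F).
Notation n := (\dim {:W}).
Implicit Types (p q f h : {mpoly F[n]}) (w : W) (X Y : W -> Prop).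

Lemma zclosed_neq0 X w : zclosed X -> X w -> w != 0.
Proof. by case=> I [_ XE] /XE[]. Qed.

Lemma zclosed_scale X w c : zclosed X -> c != 0 -> X w -> X (c *: w).
Proof.
move=> [I [hI XE]] nzc /XE[nzw w0]; apply/XE; split.
  by rewrite scaler_eq0 negb_or nzc.
move=> p Ip; have [d hp] := hI p Ip.
by rewrite (peval_homog_scale _ _ hp) w0 // mulr0.
Qed.

(** The ideal of an irreducible set is prime; only one factor need be
    homogeneous. *)
Lemma zirreducible_prime Y f h d : zirreducible Y -> f \is d.-homog ->
  (exists2 w, Y w & peval f w != 0) ->
  (forall w, Y w -> peval (f * h) w = 0) ->
  forall w, Y w -> peval h w = 0.
Proof.
case=> clY _ irrY hf [w0 Yw0 fw0] fh0.
pose Y1 w := w != 0 /\ peval f w = 0.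
pose Y2 w := w != 0 /\ forall e, peval (pihomog mdeg e h) w = 0.
have clY1 : zclosed Y1.
  exists (fun p => p = f); split; first by move=> p ->; exists d.
  by move=> w; split=> [[? ?]|[? H]]; split=> //; [move=> p -> | apply: H].
have clY2 : zclosed Y2.
  exists (fun p => exists e, p = pihomog mdeg e h); split.
    by move=> p [e ->]; exists e; apply: pihomogP.
  move=> w; split=> [[nzw H]|[nzw H]]; split=> //; first by move=> p [e ->].
  by move=> e; apply: H; exists e.
case: (irrY Y1 Y2 clY1 clY2) => [w Yw | YY1 | YY2].
- have nzw := zclosed_neq0 clY Yw.
  have [fw|fw] := eqVneq (peval f w) 0; [by left | right; split=> //].
  apply: peval_component_eq0 => c nzc; have := fh0 _ (zclosed_scale clY nzc Yw).
  rewrite pevalM (peval_homog_scale _ _ hf) => /eqP.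
  by rewrite !mulf_eq0 expf_eq0 (negPf nzc) andbF (negPf fw) => /eqP.
- by case: (YY1 _ Yw0) => _ f0; rewrite f0 eqxx in fw0.
- move=> w /YY2[_ h0].
  rewrite (pihomog_partitionE (leqnn (msize h))) peval_sum.
  by rewrite big1 // => i _; apply: h0.
Qed.

(** Linear independence of a family of polynomial functions on [X]. *)
Definition indep_on X (I : finType) (g : I -> {mpoly F[n]}) : Prop :=
  forall c : I -> F, (forall w, X w -> peval (\sum_i c i *: g i) w = 0) ->
  forall i, c i = 0.

(** The inductive step of algebraic independence along a chain [X < Y]: given
    functions independent on [X], and [f] in the ideal of [X] but not in the
    prime ideal of [Y], the products with the powers of [f] are independent on
    [Y].  Restricting a relation on [Y] to [X] kills its constant term in [f],
    and the remaining terms can be divided by [f]. *)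
Lemma indep_on_step X Y (I : finType) (g : I -> {mpoly F[n]}) f d N :
  zirreducible Y -> psub X Y -> indep_on X g -> f \is d.-homog ->
  (forall w, X w -> peval f w = 0) -> (exists2 w, Y w & peval f w != 0) ->
  indep_on Y (fun e : 'I_N * I => f ^+ e.1 * g e.2).
Proof.
move=> irrY XY ind_g hf fX fY c.
pose h (b : nat -> I -> F) j := \sum_i b j i *: g i.
suff key M (b : nat -> I -> F) :
    (forall w, Y w -> peval (\sum_(j < M) f ^+ j * h b j) w = 0) ->
    forall j i, (j < M)%N -> b j i = 0.
  move=> c0 [j i].
  pose b k i := if insub k is Some j then c (j, i) else 0.
  have bE (k : 'I_N) l : b k l = c (k, l) by rewrite /b valK.
  rewrite -bE; apply: (key N) => // w /c0 <-; congr (peval _ w).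
  rewrite [RHS](eq_bigr (fun e => c (e.1, e.2) *: (f ^+ e.1 * g e.2))); last first.
    by case.
  rewrite -(pair_bigA _ (fun k l => c (k, l) *: (f ^+ k * g l))) /=.
  apply: eq_bigr => k _; rewrite mulr_sumr; apply: eq_bigr => l _.
  by rewrite bE scalerAr.
elim: M b => [|M IH] b b0 j i; first by rewrite ltn0.
have E : \sum_(j < M.+1) f ^+ j * h b j =
    h b 0%N + f * \sum_(j < M) f ^+ j * h (fun k => b k.+1) j.
  rewrite big_ord_recl expr0 mul1r mulr_sumr; congr (_ + _).
  by apply: eq_bigr => k _; rewrite exprS mulrA.
have {}b0 w : Y w -> peval (h b 0%N) w +
    peval (f * \sum_(j < M) f ^+ j * h (fun k => b k.+1) j) w = 0.
  by move/b0; rewrite E pevalD.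
have b00 : forall i, b 0%N i = 0.
  apply: ind_g => w Xw; have := b0 w (XY _ Xw).
  by rewrite pevalM fX // mul0r addr0.
have h0 : h b 0%N = 0 by rewrite /h big1 // => l _; rewrite b00 scale0r.
case: j => [|j] // jM; apply: (IH (fun k => b k.+1)) => //.
apply: (zirreducible_prime irrY hf fY) => w /b0.
by rewrite h0 {1}/peval meval0 add0r.
Qed.
End Irreducible.

(** Exponents [(m_0, ..., m_k)] with all [m_i < N], and the corresponding
    monomials in [f_0, ..., f_k]. *)
Fixpoint expo (k N : nat) : finType :=
  if k is k'.+1 then ('I_N * expo k' N)%type : finType else 'I_N.

Fixpoint monom (R : nzRingType) (f : nat -> R) k N : expo k N -> R :=
  match k return expo k N -> R with
  | 0 => fun j => f 0%N ^+ j
  | k'.+1 => fun e => f k'.+1 ^+ e.1 * monom f e.2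
  end.

Lemma card_expo k N : #|{: expo k N}| = (N ^ k.+1)%N.
Proof.
elim: k => [|k IH] /=; first by rewrite card_ord expn1.
by rewrite card_prod card_ord IH -expnS.
Qed.

Lemma rmorph_monom (R S : nzRingType) (phi : {rmorphism R -> S}) f k N
    (e : expo k N) : phi (monom f e) = monom (phi \o f) e.
Proof.
by elim: k e => [|k IH] e /=; rewrite ?rmorphM ?rmorphXn ?IH.
Qed.

(* [msize] is one more than the degree, and [msizeM_le] is off by two for
   nonzero factors; the bounds below only need to be linear in the exponent. *)
Lemma msize_exp_le n (R : idomainType) (p : {mpoly R[n]}) j :
  ((msize (p ^+ j)).+1 <= j * (msize p).+1 + 2)%N.
Proof.
elim: j => [|j IH]; first by rewrite expr0 msize1.
rewrite exprS; have := msizeM_le p (p ^+ j); rewrite mulSn; lia.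
Qed.

Lemma msize_monom_le n (R : idomainType) (f : nat -> {mpoly R[n]}) k :
  exists K, forall N (e : expo k N), (msize (monom f e) <= K * N)%N.
Proof.
elim: k => [|k [K IH]].
  exists (msize (f 0%N) + 3)%N => N j /=.
  have jN : (j * (msize (f 0%N)).+1 <= N * (msize (f 0%N)).+1)%N.
    by rewrite leq_mul2r ltnW ?orbT.
  move: (msize_exp_le (f 0%N) j) jN (ltn_ord j).
  move: (j * _)%N => x; move: (msize (f 0%N ^+ j)) (msize (f 0%N)) => a s.
  by move: (nat_of_ord j) => i; nia.
exists (K + (msize (f k.+1) + 4))%N => N [j e] /=.
have jN : (j * (msize (f k.+1)).+1 <= N * (msize (f k.+1)).+1)%N.
  by rewrite leq_mul2r ltnW ?orbT.
move: (msizeM_le (f k.+1 ^+ j) (monom f e)) (IH N e) jN (ltn_ord j).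
move: (msize_exp_le (f k.+1) j); move: (j * _)%N => x.
move: (msize (_ * _)) => b; move: (msize (_ ^+ _)) => a.
move: (msize (monom f e)) => c; move: (msize (f k.+1)) => s.
by move: (nat_of_ord j) => i; nia.
Qed.

Lemma card_bmultinom_le k b : (#|{: 'X_{1..k < b}}| <= b ^ k)%N.
Proof.
have lt_b (m : 'X_{1..k < b}) i : (m i < b)%N.
  apply: leq_ltn_trans (bmdeg m).
  by rewrite mdegE (bigD1 i) //= leq_addr.
pose phi (m : 'X_{1..k < b}) : {ffun 'I_k -> 'I_b} :=
  [ffun i => Ordinal (lt_b m i)].
have phi_inj : injective phi.
  move=> m1 m2 /ffunP E; apply/val_inj/mnmP => i.
  by have := congr1 val (E i); rewrite !ffunE.
by have := leq_card phi phi_inj; rewrite card_ffun !card_ord.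
Qed.

(** Polynomials of degree less than [b] in [k] variables, more than [b ^ k] in
    number, are linearly dependent. *)
Lemma mpoly_dependent (F : fieldType) k b (I : finType)
    (g : I -> {mpoly F[k]}) :
  (forall i, msize (g i) <= b)%N -> (b ^ k < #|I|)%N ->
  exists2 c : I -> F, exists i, c i != 0 & \sum_i c i *: g i = 0.
Proof.
move=> gb cardI.
pose A : 'M[F]_(#|I|, #|{: 'X_{1..k < b}}|) :=
  \matrix_(i, j) (g (enum_val i))@_(enum_val j : 'X_{1..k < b}).
have /rowV0Pn[v /sub_kermxP vA nzv] : kermx A != 0.
  rewrite kermx_eq0 /row_free neq_ltn (leq_ltn_trans (rank_leq_col A)) //.
  exact: leq_ltn_trans (card_bmultinom_le _ _) _.
exists (fun i => v 0 (enum_rank i)).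
  by have /rV0Pn[j vj] := nzv; exists (enum_val j); rewrite enum_valK.
apply/mpolyP => m; rewrite mcoeff0 raddf_sum /=.
under eq_bigr do rewrite mcoeffZ.
have [mb|bm] := ltnP (mdeg m) b; last first.
  rewrite big1 // => i _; rewrite memN_msupp_eq0 ?mulr0 //.
  by apply: msize_mdeg_ge; apply: leq_trans bm.
have := congr1 (fun M : 'rV_ _ => M 0 (enum_rank (BMultinom mb))) vA.
rewrite !mxE => E0; rewrite -[RHS]E0 [RHS](reindex enum_rank) /=; last first.
  exact/onW_bij/enum_rank_bij.
by apply: eq_bigr => i _; rewrite mxE !enum_rankK.
Qed.

Section ChainBound.
Variables (F : numFieldType) (W : vectType F).
Notation n := (\dim {:W}).

(** A chain of irreducible closed sets yields algebraically independent
    functions on its top: a linear form that is nonzero on the bottom, and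
    for every step a form that vanishes on the smaller set but not on the
    larger one. *)
Lemma chain_indep (X : nat -> W -> Prop) (f : nat -> {mpoly F[n]}) (d : nat) N :
  (forall i, (i <= d)%N -> zirreducible (X i)) ->
  (forall i, (i < d)%N -> psub (X i) (X i.+1)) ->
  f 0%N \is 1.-homog -> (exists2 w, X 0%N w & peval (f 0%N) w != 0) ->
  (forall i, (i < d)%N -> [/\ exists e, f i.+1 \is e.-homog,
     forall w, X i w -> peval (f i.+1) w = 0 &
     exists2 w, X i.+1 w & peval (f i.+1) w != 0]) ->
  indep_on (X d) (monom f (k := d) (N := N)).
Proof.
move=> irrX subX hf0 [w0 Xw0 fw0] hf.
elim: d irrX subX hf => [|d IH] irrX subX hf.
  move=> c c0; pose Q : {poly F} := \sum_(j < N) (c j * peval (f 0%N) w0 ^+ j) *: 'X^j.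
  have clX : zclosed (X 0%N) by case: (irrX 0%N).
  have Q0 : Q = 0.
    apply: (@poly_eq0_generic _ _ 'X); first by rewrite polyX_eq0.
    move=> t; rewrite hornerX => nzt.
    rewrite -[RHS](c0 _ (zclosed_scale clX nzt Xw0)) peval_sum horner_sum.
    apply: eq_bigr => j _; rewrite hornerZ hornerXn /= pevalZ pevalXn.
    by rewrite (peval_homog_scale _ _ hf0) expr1 exprMn; ring.
  move=> i; have := congr1 (coefp i) Q0.
  rewrite /= coef0 coef_sum (bigD1 i) //= coefZ coefXn eqxx mulr1 big1 ?addr0.
    by move/eqP; rewrite mulf_eq0 expf_eq0 (negPf fw0) andbF orbF => /eqP.
  by move=> j ji; rewrite coefZ coefXn eq_sym val_eqE (negPf ji) mulr0.
have [[e hfd] fX fY] := hf d (ltnSn d).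
apply: (indep_on_step (irrX _ (leqnn _)) (subX _ (ltnSn d)) _ hfd fX fY).
by apply: IH => i id; [apply: irrX | apply: subX | apply: hf];
  rewrite ltnW // ltnS ltnW.
Qed.

(** If every polynomial that vanishes on the image of [Psi : F^k -> W]
    vanishes on the cone [S], then the closure of [S] has dimension less
    than [k]: functions that are algebraically independent on a subset of the
    closure stay so after composition with [Psi]. *)
Lemma local_chain_bound k (S : W -> Prop) (Psi : 'I_n -> {mpoly F[k]}) :
  (forall w c, S w -> S (c *: w)) ->
  (forall p : {mpoly F[n]}, (p \mPo [tuple Psi i | i < n]) = 0 ->
     forall w, S w -> peval p w = 0) ->
  forall w d, local_chain (zclosure S) w d -> (d < k)%N.
Proof.
move=> Sscale dense w d [X [hX hchain]].
have irrX i : (i <= d)%N -> zirreducible (X i) by case/hX.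
have subX i : (i < d)%N -> psub (X i) (X i.+1) by case/hchain.
have /choice[f hf] i : exists f : {mpoly F[n]}, (i < d)%N ->
    [/\ exists e, f \is e.-homog, forall w, X i w -> peval f w = 0 &
     exists2 w, X i.+1 w & peval f w != 0].
  have [id|] := boolP (i < d)%N; last by exists 0.
  have [_ /existsNP[x /not_implyP[Xx nXx]]] := hchain i id.
  have [[J [hJ XJ]] _ _] := irrX _ (ltnW id).
  have nzx : x != 0 by apply: zclosed_neq0 Xx; case: (irrX i.+1 id).
  have [p [Jp px]] : exists p, J p /\ peval p x <> 0.
    apply: contra_notP nXx => /forallNP H; apply/XJ; split=> // p Jp.
    by have /not_andP[|/contrapT] := H p.
  exists p => _; split; [exact: hJ | by move=> y /XJ[_]; apply |].
  by exists x => //; apply/eqP.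
have [_ X0w _] := hX 0%N (leq0n d).
have nzw : w != 0 by apply: zclosed_neq0 X0w; case: (irrX 0%N).
have [j0 wj0] := exists_coord_neq0 nzw.
pose g i := if i is i'.+1 then f i' else 'X_j0.
rewrite ltnNge; apply/negP => kd.
pose q i := g i \mPo [tuple Psi i | i < n].
have [K hK] := msize_monom_le q d.
(* There are [N ^ d.+1] monomials and at most [(K N) ^ k] coefficients. *)
pose N := (K ^ k).+1.
have [|c [i ci] c0] := mpoly_dependent (hK N).
  rewrite card_expo expnMn (@leq_trans (N ^ k.+1)%N) //.
    by rewrite expnSr mulnC ltn_pmul2l // expn_gt0.
  by rewrite leq_pexp2l.
suff /(_ i)/eqP : forall i, c i = 0 by rewrite (negPf ci).
apply: (chain_indep irrX subX (f := g)) => [||j jd|].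
- by rewrite /g dhomogX /= mdeg1.
- by exists w; rewrite // /peval /g mevalXU.
- exact: hf.
move=> y Xy; have [_ Zy] : zclosure S y by have [_ _] := hX d (leqnn d); apply.
(* A relation on the image of [Psi] propagates to the closure of [S], one
   homogeneous component at a time. *)
set p := \sum_i _; rewrite (pihomog_partitionE (leqnn (msize p))) peval_sum.
rewrite big1 // => e _; apply: Zy; split; first by exists (e : nat); apply: pihomogP.
move=> z _ Sz; apply: peval_component_eq0 => t _.
apply: dense; last exact: Sscale.
rewrite -[RHS]c0 /p raddf_sum /=; apply: eq_bigr => l _.
by rewrite comp_mpolyZ (rmorph_monom (comp_mpoly [tuple Psi i | i < n])).
Qed.
End ChainBound.

(** * Secant planes and the singular point *)

Section Lines.
Variables (F : numFieldType) (n : nat).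

Lemma horner_mmap (h : 'I_n -> {poly F}) (p : {mpoly F[n]}) t :
  (mmap polyC h p).[t] = p.@[fun i => (h i).[t]].
Proof.
rewrite mevalE /mmap horner_sum; apply: eq_bigr => m _.
rewrite hornerM hornerC horner_prod; congr (_ * _).
by apply: eq_bigr => i _; rewrite horner_exp.
Qed.

Lemma deriv_mmap (h : 'I_n -> {poly F}) (p : {mpoly F[n]}) :
  (mmap polyC h p)^`() = \sum_i mmap polyC h (mderiv i p) * (h i)^`().
Proof.
pose D p := (mmap polyC h p)^`() = \sum_i mmap polyC h (mderiv i p) * (h i)^`().
have D1 : D 1.
  rewrite /D rmorph1 derivC big1 // => i _.
  by rewrite -mpolyC1 mderivC rmorph0 mul0r.
have DM q r : D q -> D r -> D (q * r).
  rewrite /D => Dq Dr; rewrite rmorphM derivM Dq Dr.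
  rewrite mulr_suml mulr_sumr -big_split /=; apply: eq_bigr => i _.
  by rewrite mderivM rmorphD !rmorphM /=; ring.
have DX i : D 'X_i.
  rewrite /D mmapX mmap1U (bigD1 i) //= big1 => [|j ji]; last first.
    by rewrite mderivX mnm1E eq_sym (negPf ji) scale0r rmorph0 mul0r.
  have UU : (U_(i) - U_(i))%MM = 0%MM by apply/mnmP => k; rewrite mnmBE subnn mnm0E.
  by rewrite mderivX mnm1E eqxx scale1r UU mpolyX0 rmorph1 mul1r addr0.
elim/mpolyind: p => [|c m p _ _ Dp].
  by rewrite rmorph0 deriv0 big1 // => i _; rewrite mderiv0 rmorph0 mul0r.
have Dm : D 'X_[m].
  rewrite mpolyXE_id; apply: (big_ind D) => // i _.
  by elim: (m i) => [|k IH]; rewrite ?expr0 // exprS; apply: DM.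
rewrite raddfD /= mmapZ derivD derivM derivC mul0r add0r Dp Dm.
rewrite mulr_sumr -big_split /=; apply: eq_bigr => i _.
by rewrite mderivD mderivZ raddfD /= mmapZ mulrDl mulrA.
Qed.
End Lines.

(** A polynomial that vanishes along a line has vanishing derivative in the
    direction of that line. *)
Lemma tangent_of_line (F : numFieldType) (W : vectType F)
    (p : {mpoly F[\dim {:W}]}) (w u : W) : w != 0 ->
  (forall t, w + t *: u != 0 -> peval p (w + t *: u) = 0) ->
  \sum_i peval (mderiv i p) w * coord (vbasis {:W}) i u = 0.
Proof.
move=> nzw p0; pose x i := coord (vbasis {:W}) i.
pose h i : {poly F} := (x i w)%:P + x i u *: 'X.
have hE i t : (h i).[t] = x i (w + t *: u).
  by rewrite !hornerE /x linearD linearZ /= mulrC.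
have [j0 wj0] := exists_coord_neq0 nzw.
have Q0 : mmap polyC h p = 0.
  apply: (@poly_eq0_generic _ _ (h j0)) => [|t].
    apply: contra_neq wj0 => h0.
    by have := hE j0 0; rewrite h0 horner0 scale0r addr0.
  rewrite hE => nzt; rewrite horner_mmap; transitivity (peval p (w + t *: u)).
    by apply: meval_eq => i; rewrite hE.
  by apply: p0; apply: contra_neq nzt => ->; rewrite /x linear0.
have := congr1 (fun q : {poly F} => q.[0]) (deriv_mmap h p).
rewrite /= Q0 deriv0 horner0 horner_sum => {2}->; apply: eq_bigr => i _.
rewrite hornerM horner_mmap /h derivD derivC derivZ derivX add0r.
rewrite hornerZ hornerC mulr1; congr (_ * _).
by apply: meval_eq => j; rewrite hE scale0r addr0.
Qed.

(** Coefficients of [(p e_0 + q e_1 + r e_2)^2] on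
    [e_0^2, e_0 e_1, e_0 e_2, e_1^2, e_1 e_2, e_2^2]. *)
Definition sq_coef (R : comNzRingType) (p q r : R) (j : 'I_6) : R :=
  nth 0 [:: p ^+ 2; 2%:R * p * q; 2%:R * p * r; q ^+ 2; 2%:R * q * r; r ^+ 2] j.

(** Coefficients of [a (vw)^2 + b (v^2)^2 + c (w^2)^2], where the products of
    [v = (v0, v1)] and [w = (w0, w1)] are written in terms of the generators
    [e_0 = x^2, e_1 = 2 x y, e_2 = y^2] of the symmetric square, and [vw] stands
    for twice the product, the polarization of [v^2]. *)
Definition plane_coef (R : comNzRingType) (v0 v1 w0 w1 a b c : R) (j : 'I_6) : R :=
  a * sq_coef (2%:R * v0 * w0) (v0 * w1 + w0 * v1) (2%:R * v1 * w1) j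
  + b * sq_coef (v0 ^+ 2) (v0 * v1) (v1 ^+ 2) j
  + c * sq_coef (w0 ^+ 2) (w0 * w1) (w1 ^+ 2) j.

Lemma rmorph_plane_coef (R S : comNzRingType) (f : {rmorphism R -> S})
    v0 v1 w0 w1 a b c j :
  f (plane_coef v0 v1 w0 w1 a b c j) =
  plane_coef (f v0) (f v1) (f w0) (f w1) (f a) (f b) (f c) j.
Proof.
rewrite /plane_coef /sq_coef; case: j => [[|[|[|[|[|[|//]]]]]] ?] /=;
by rewrite !(rmorphD, rmorphM, rmorphXn, rmorph_nat).
Qed.

Section SecantPlanes.
Variables (F : numFieldType) (W : vectType F) (B : 'I_6 -> W).
Notation n := (\dim {:W}).

(** The point with these coefficients; [B] lists the products of the generators,
    in the order of [sq_coef]. *)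
Definition plane_point (v0 v1 w0 w1 a b c : F) : W :=
  \sum_j plane_coef v0 v1 w0 w1 a b c j *: B j.

(** The union of the planes spanned by [(vw)^2, (v^2)^2, (w^2)^2], for [v], [w]
    linearly independent. *)
Definition secant_planes (x : W) : Prop :=
  exists v0 v1 w0 w1 a b c,
    v0 * w1 - v1 * w0 != 0 /\ x = plane_point v0 v1 w0 w1 a b c.

Lemma plane_pointZ k v0 v1 w0 w1 a b c :
  k *: plane_point v0 v1 w0 w1 a b c =
  plane_point v0 v1 w0 w1 (k * a) (k * b) (k * c).
Proof.
rewrite /plane_point scaler_sumr; apply: eq_bigr => j _; rewrite scalerA.
by congr (_ *: _); rewrite /plane_coef; ring.
Qed.

Lemma plane_pointD v0 v1 w0 w1 a b c a' b' c' :
  plane_point v0 v1 w0 w1 a b c + plane_point v0 v1 w0 w1 a' b' c' =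
  plane_point v0 v1 w0 w1 (a + a') (b + b') (c + c').
Proof.
rewrite /plane_point -big_split /=; apply: eq_bigr => j _; rewrite -scalerDl.
by congr (_ *: _); rewrite /plane_coef; ring.
Qed.

Lemma secant_planesZ x k : secant_planes x -> secant_planes (k *: x).
Proof.
case=> v0 [v1 [w0 [w1 [a [b [c [D ->]]]]]]].
by exists v0, v1, w0, w1, (k * a), (k * b), (k * c); rewrite plane_pointZ.
Qed.

Lemma plane_point_normalize v0 v1 w0 w1 a b c : v1 != 0 -> w1 != 0 ->
  plane_point v0 v1 w0 w1 a b c =
  plane_point (v0 / v1) 1 (w0 / w1) 1
    (a * v1 ^+ 2 * w1 ^+ 2) (b * v1 ^+ 4) (c * w1 ^+ 4).
Proof.
move=> nzv nzw; apply: eq_bigr => j _; congr (_ *: _).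
rewrite /plane_coef /sq_coef; case: j => [[|[|[|[|[|[|//]]]]]] ?] /=; field;
by rewrite ?nzv ?nzw.
Qed.

(** The planes with [v1, w1 != 0] are parametrized by five variables. *)
Definition plane_param (i : 'I_n) : {mpoly F[5]} :=
  let X k : {mpoly F[5]} := 'X_(inord k) in
  \sum_j coord (vbasis {:W}) i (B j) *:
     plane_coef (X 0%N) 1 (X 1%N) 1 (X 2) (X 3) (X 4) j.

Lemma plane_paramE x0 x1 x2 x3 x4 i :
  (plane_param i).@[fun k : 'I_5 => nth 0 [:: x0; x1; x2; x3; x4] k] =
  coord (vbasis {:W}) i (plane_point x0 1 x1 1 x2 x3 x4).
Proof.
rewrite /plane_param /plane_point !raddf_sum /=; apply: eq_bigr => j _.
rewrite mevalZ linearZ /= mulrC; congr (_ * _).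
by rewrite rmorph_plane_coef /= !mevalXU !meval1 !inordK.
Qed.

(** Planes with [v1 = 0] or [w1 = 0] are limits, along [v + t (0, 1)] and
    [w + t (0, 1)], of planes covered by the parametrization. *)
Lemma plane_param_dense (p : {mpoly F[n]}) :
  p \mPo [tuple plane_param i | i < n] = 0 ->
  forall x, secant_planes x -> peval p x = 0.
Proof.
move=> p0 x [v0 [v1 [w0 [w1 [a [b [c [_ ->]]]]]]]].
have param0 x0 x1 x2 x3 x4 : peval p (plane_point x0 1 x1 1 x2 x3 x4) = 0.
  have := congr1 (meval (fun k : 'I_5 => nth 0 [:: x0; x1; x2; x3; x4] k)) p0.
  rewrite comp_mpoly_meval meval0 => <-; apply: meval_eq => i.
  by rewrite tnth_mktuple plane_paramE.
have norm0 t : v1 + t != 0 -> w1 + t != 0 ->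
    peval p (plane_point v0 (v1 + t) w0 (w1 + t) a b c) = 0.
  by move=> nzv nzw; rewrite plane_point_normalize.
pose h i : {poly F} := \sum_j coord (vbasis {:W}) i (B j) *:
  plane_coef v0%:P (v1%:P + 'X) w0%:P (w1%:P + 'X) a%:P b%:P c%:P j.
have QE t : (mmap polyC h p).[t] =
    peval p (plane_point v0 (v1 + t) w0 (w1 + t) a b c).
  rewrite horner_mmap; apply: meval_eq => i; rewrite horner_sum raddf_sum /=.
  apply: eq_bigr => j _; rewrite hornerZ linearZ /= mulrC; congr (_ * _).
  by rewrite -/(horner_eval t _) rmorph_plane_coef /= /horner_eval !hornerE.
have Q0 : mmap polyC h p = 0.
  apply: (@poly_eq0_generic _ _ ((v1%:P + 'X) * (w1%:P + 'X))).
    by rewrite mulf_neq0 // addrC monic_neq0 // monicXaddC.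
  move=> t; rewrite hornerM !hornerE mulf_eq0 negb_or => /andP[nzv nzw].
  by rewrite QE norm0.
by have := QE 0; rewrite Q0 horner0 !addr0.
Qed.

Hypothesis freeB : forall c : 'I_6 -> F, \sum_j c j *: B j = 0 -> forall j, c j = 0.

Variable m : F.
Hypothesis nzm : m != 0.

(** Coefficients of [m (- m e_1^2 + 2 m^2 e_0^2 + 2 e_2^2)]. *)
Definition cayley_coef (j : 'I_6) : F :=
  nth 0 [:: 2%:R * m ^+ 3; 0; 0; - m ^+ 2; 0; 2%:R * m] j.

Definition cayley_point : W := \sum_j cayley_coef j *: B j.

(** The secant planes through the Cayley point: the pairs [(al, 1)], [(ga, 1)]
    with [al * ga = m]. *)
Lemma cayley_point_plane al ga : al * ga = m -> al != ga ->
  let D := (al - ga) ^- 2 in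
  cayley_point = plane_point al 1 ga 1 (- m ^+ 2 * D)
    (2%:R * m * ga ^+ 2 * D) (2%:R * m * al ^+ 2 * D).
Proof.
move=> al_ga nE D; apply: eq_bigr => j _; congr (_ *: _).
have nz : al - ga != 0 by rewrite subr_eq0.
rewrite /D /cayley_coef /plane_coef /sq_coef -al_ga.
by case: j => [[|[|[|[|[|[|//]]]]]] ?] /=; field.
Qed.

Lemma cayley_point_neq0 : cayley_point != 0.
Proof.
apply: contra_neq nzm => /freeB/(_ (inord 5)).
by rewrite /cayley_coef inordK //= => /eqP; rewrite mulf_eq0 pnatr_eq0 => /eqP.
Qed.

Lemma cayley_point_secant : secant_planes cayley_point.
Proof.
have [al nz2 nzal] : exists2 al : F, al ^+ 2 != m & al != 0.
  have [m1|] := eqVneq (1 ^+ 2) m; last by exists 1; rewrite ?oner_eq0.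
  exists 2%:R; last by rewrite pnatr_eq0.
  by rewrite -m1 expr1n -natrX pnatr_eq1.
have nE : al != m / al.
  by apply: contra_neq nz2 => E; rewrite expr2 {2}E mulrC divfK.
have al_ga : al * (m / al) = m by rewrite mulrC divfK.
exists al, 1, (m / al), 1; do 3!eexists; split; last first.
  exact: cayley_point_plane al_ga nE.
by rewrite mulr1 mul1r subr_eq0.
Qed.

(** A secant plane through the Cayley point lies in the tangent space there, and
    these planes together span all six coordinate directions. *)
Lemma cayley_point_tangent j :
  B j \in cone_tangent (zclosure secant_planes) cayley_point.
Proof.
have [subU _] := vspanP (fun u : W => forall p,
    in_ideal (zclosure secant_planes) p ->
    \sum_i peval (mderiv i p) cayley_point * coord (vbasis {:W}) i u = 0).
apply: (subU) => {subU} p [_ Ip].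
pose tau (u : W) := \sum_i peval (mderiv i p) cayley_point * coord (vbasis {:W}) i u.
have tau_sum (c : 'I_6 -> F) : tau (\sum_k c k *: B k) = \sum_k c k * tau (B k).
  under [RHS]eq_bigr do rewrite mulr_sumr.
  rewrite exchange_big /=; apply: eq_bigr => i _.
  rewrite linear_sum mulr_sumr; apply: eq_bigr => k _.
  by rewrite linearZ /= mulrCA.
have plane0 al ga a b c : al * ga = m -> al != ga ->
    tau (plane_point al 1 ga 1 a b c) = 0.
  move=> al_ga nE; apply: tangent_of_line cayley_point_neq0 _ => t nzt.
  apply: Ip => //; split=> // q [_ Sq]; apply: Sq => //.
  rewrite (cayley_point_plane al_ga nE) plane_pointZ plane_pointD.
  do 7!eexists; split; last by [].
  by rewrite mulr1 mul1r subr_eq0.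
pose y k := tau (B (inord k)).
have tauE (c : 'I_6 -> F) : \sum_k c k * tau (B k) = \sum_(k < 6) c k * y k.
  by apply: eq_bigr => k _; rewrite /y inord_val.
(* The value of [tau] at the square of [al^2 e_0 + al e_1 + e_2] is a polynomial
   in [al] that vanishes for all [al] with [al != 0] and [al ^+ 2 != m]. *)
pose cf := [:: y 5; 2%:R * y 4; 2%:R * y 2 + y 3; 2%:R * y 1%N; y 0%N].
have Q0 : \poly_(k < 5) nth 0 cf k = 0.
  apply: (@poly_eq0_generic _ _ ('X * ('X^2 - m%:P))).
    by rewrite mulf_neq0 ?polyX_eq0 // monic_neq0 // monicXnsubC.
  move=> al; rewrite hornerM !hornerE mulf_eq0 negb_or subr_eq0 => /andP[nzal nz2].
  have nE : al != m / al.
    by apply: contra_neq nz2 => E; rewrite expr2 {2}E mulrC divfK.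
  have al_ga : al * (m / al) = m by rewrite mulrC divfK.
  have := plane0 _ _ 0 1 0 al_ga nE; rewrite tau_sum tauE => {2}<-.
  rewrite horner_poly !big_ord_recl !big_ord0 /cf /plane_coef /sq_coef /bump /=.
  by ring.
have coefs k : nth 0 cf k = 0.
  have [k5|k5] := ltnP k 5; last by rewrite nth_default.
  have := congr1 (coefp k) Q0; rewrite /= coef0 => {2}<-.
  by rewrite coef_poly k5.
have two0 : 2%:R != 0 :> F by rewrite pnatr_eq0.
have y0 : y 0%N = 0 := coefs 4.
have y5 : y 5 = 0 := coefs 0%N.
have y1 : y 1%N = 0 by apply: (mulfI two0); rewrite mulr0; exact: (coefs 3).
have y4 : y 4 = 0 by apply: (mulfI two0); rewrite mulr0; exact: (coefs 1%N).
have y23 : 2%:R * y 2 + y 3 = 0 := coefs 2.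
(* The squares only give [2 y_2 + y_3 = 0]; the Cayley point itself separates
   the two. *)
have y3 : y 3 = 0.
  have : tau cayley_point = 0.
    apply: tangent_of_line cayley_point_neq0 _ => t nzt; apply: Ip => //.
    split=> // q [_ Sq]; apply: Sq => //.
    rewrite -{1}[cayley_point]scale1r -scalerDl; apply: secant_planesZ.
    exact: cayley_point_secant.
  rewrite tau_sum tauE !big_ord_recl big_ord0 /cayley_coef /bump /=.
  rewrite y0 y5 !mul0r !mulr0 !add0r !addr0 mulNr => /eqP.
  by rewrite oppr_eq0 mulf_eq0 expf_eq0 (negPf nzm) => /eqP.
have y2 : y 2 = 0 by apply: (mulfI two0); rewrite mulr0 -y23 y3 addr0.
suff /(_ j) : forall k : 'I_6, y k = 0 by rewrite /y inord_val.
by case=> [[|[|[|[|[|[|//]]]]]] ?].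
Qed.

(** The closure of the secant planes has dimension at most four, and the tangent
    space of its cone at the Cayley point has dimension at least six. *)
Theorem cayley_point_singular :
  singular_point (zclosure secant_planes) cayley_point.
Proof.
split.
  split=> [|p [_ Sp]]; first exact: cayley_point_neq0.
  by apply: Sp; [exact: cayley_point_neq0 | exact: cayley_point_secant].
move=> d /(local_chain_bound secant_planesZ plane_param_dense) d5.
apply: leq_trans d5 _; pose T := cone_tangent (zclosure secant_planes) cayley_point.
have freeT : free [tuple B i | i < 6].
  apply/freeP => c c0; apply: freeB; rewrite -[RHS]c0; apply: eq_bigr => i _.
  by rewrite -tnth_nth tnth_mktuple.
have /dimvS : (<<[tuple B i | i < 6]>> <= T)%VS.
  apply/span_subvP => x /tnthP[i ->]; rewrite tnth_mktuple.
  exact: cayley_point_tangent.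
by rewrite (eqnP freeT) size_tuple -/T; case: (\dim T).
Qed.
End SecantPlanes.

(** * Squares of the three basic forms *)

Section Squares.
Variable F : numFieldType.

Lemma cup2Dl m (a b c : kform F 2 m) : cup2 (a + b) c = cup2 a c + cup2 b c.
Proof. exact: (wedgeDl a b c). Qed.

Lemma cup2Dr m (a b c : kform F 2 m) : cup2 a (b + c) = cup2 a b + cup2 a c.
Proof. exact: (wedgeDr a b c). Qed.

Lemma cup2Zl m k (a b : kform F 2 m) : cup2 (k *: a) b = k *: cup2 a b.
Proof. exact: (wedgeZl k a b). Qed.

Lemma cup2Zr m k (a b : kform F 2 m) : cup2 a (k *: b) = k *: cup2 a b.
Proof. exact: (wedgeZr k a b). Qed.

Lemma pull_cup2 m m' (A : 'M[F]_(m', m)) (a b : kform F 2 m') :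
  pull A (cup2 a b) = cup2 (pull A a) (pull A b).
Proof. exact: (pull_wedge A a b). Qed.

Lemma cup2_alternating m (a b : kform F 2 m) : alternating (cup2 a b).
Proof. exact: (wedge_alternating a b). Qed.

Lemma congruence_skew m m' (A : 'M[F]_(m', m)) (M : 'M[F]_m') :
  M^T = - M -> (A^T *m M *m A)^T = - (A^T *m M *m A).
Proof. by move=> skM; rewrite !trmx_mul trmxK skM mulNmx mulmxN mulmxA. Qed.

Lemma cup2_comm m (M N : 'M[F]_m) : M^T = - M -> N^T = - N ->
  cup2 (form_of_mx M) (form_of_mx N) = cup2 (form_of_mx N) (form_of_mx M).
Proof.
move=> skM skN; apply: formP => t; rewrite !cup2_form_of_mx // /polar_pfaffian; ring.
Qed.

(** The products of [e0, e1, e2], in the order of [sq_coef]. *)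
Definition sq_basis m (e0 e1 e2 : kform F 2 m) (j : 'I_6) : kform F 4 m :=
  nth 0 [:: cup2 e0 e0; cup2 e0 e1; cup2 e0 e2; cup2 e1 e1; cup2 e1 e2; cup2 e2 e2] j.

Lemma cup2_sq m (e0 e1 e2 : kform F 2 m) p q r :
  cup2 e0 e1 = cup2 e1 e0 -> cup2 e0 e2 = cup2 e2 e0 -> cup2 e1 e2 = cup2 e2 e1 ->
  let w := p *: e0 + q *: e1 + r *: e2 in
  cup2 w w = \sum_j sq_coef p q r j *: sq_basis e0 e1 e2 j.
Proof.
move=> c01 c02 c12 w; rewrite /w !(cup2Dl, cup2Dr, cup2Zl, cup2Zr) -c01 -c02 -c12.
rewrite !big_ord_recl big_ord0 /sq_coef /sq_basis /=.
by apply: formP => t; rewrite !(formDE, formZE, form0E); ring.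
Qed.

Lemma hyperbolic_mx_pull m m' (A : 'M[F]_(m', m)) (a b c d : 'rV[F]_m') :
  A^T *m hyperbolic_mx a b c d *m A =
  hyperbolic_mx (a *m A) (b *m A) (c *m A) (d *m A).
Proof.
rewrite /hyperbolic_mx !trmx_mul !(mulmxDr, mulmxDl, mulmxN, mulNmx).
by rewrite !mulmxA.
Qed.

Lemma hyperbolic_mxE m (a b c d : 'rV[F]_m) i j :
  hyperbolic_mx a b c d i j = a 0 i * b 0 j - b 0 i * a 0 j
    + (c 0 i * d 0 j - d 0 i * c 0 j).
Proof. by rewrite !mxE !big_ord1 !mxE. Qed.

Lemma hyperbolic_mx_skew m (a b c d : 'rV[F]_m) :
  (hyperbolic_mx a b c d)^T = - hyperbolic_mx a b c d.
Proof.
apply/matrixP => i j; rewrite mxE [RHS]mxE !hyperbolic_mxE; ring.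
Qed.

(** For a symplectic form in four variables, the six products of the three
    basic forms on the square are linearly independent: six values on tuples
    of basis vectors form a triangular system. *)
Lemma sq_basis_free (D : 'M[F]_4) : D \in unitmx ->
  let M := hyperbolic_mx (row (inord 0) D) (row (inord 1) D)
                         (row (inord 2) D) (row (inord 3) D) in
  let e p q r := form_of_mx (quad_mx M p q r) in
  forall c : 'I_6 -> F,
    \sum_j c j *: sq_basis (e 1 0 0) (e 0 1 0) (e 0 0 1) j = 0 ->
    forall j, c j = 0.
Proof.
move=> uD M e c c0.
(* After the change of basis by [D], the form is [dx_0 /\ dx_1 + dx_2 /\ dx_3]. *)
pose d k : 'rV[F]_4 := delta_mx 0 (inord k).
pose J := hyperbolic_mx (d 0) (d 1) (d 2) (d 3).
have MJ : (invmx D)^T *m M *m invmx D = J.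
  by rewrite hyperbolic_mx_pull !rowE -!mulmxA mulmxV // !mulmx1.
have skJ : J^T = - J := hyperbolic_mx_skew _ _ _ _.
pose f p q r := form_of_mx (quad_mx J p q r).
have {}c0 : \sum_j c j *: sq_basis (f 1 0 0) (f 0 1 0) (f 0 0 1) j = 0.
  pose A := block_mx (invmx D) 0 0 (invmx D).
  have pf p q r : pull A (e p q r) = f p q r by rewrite pull_quad_diag MJ.
  have := congr1 (pull A) c0; rewrite pull0 pull_sum; apply: etrans.
  apply: eq_bigr => j _; rewrite pullZ; congr (_ *: _).
  by case: j => [[|[|[|[|[|[|//]]]]]] ?]; rewrite /sq_basis /= pull_cup2 !pf.
have JE i j : (i < 4)%N -> (j < 4)%N -> J (inord i) (inord j) =
    (i == 0%N)%:R * (j == 1%N)%:R - (i == 1%N)%:R * (j == 0%N)%:R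
    + ((i == 2)%:R * (j == 3)%:R - (i == 3)%:R * (j == 2)%:R).
  move=> i4 j4; rewrite hyperbolic_mxE !mxE !eqxx /=.
  by rewrite -!val_eqE /= !inordK.
pose x k : 'I_(4 + 4) := lshift 4 (inord k).
pose y k : 'I_(4 + 4) := rshift 4 (inord k).
have xx p q r i j : quad_mx J p q r (x i) (x j) = p * J (inord i) (inord j).
  by rewrite block_mxEul mxE.
have xy p q r i j : quad_mx J p q r (x i) (y j) = q * J (inord i) (inord j).
  by rewrite block_mxEur mxE.
have yx p q r i j : quad_mx J p q r (y i) (x j) = q * J (inord i) (inord j).
  by rewrite block_mxEdl mxE.
have yy p q r i j : quad_mx J p q r (y i) (y j) = r * J (inord i) (inord j).
  by rewrite block_mxEdr mxE.
pose T (a0 a1 a2 a3 : 'I_(4 + 4)) : {ffun 'I_4 -> 'I_(4 + 4)} :=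
  [ffun k : 'I_4 => nth a0 [:: a0; a1; a2; a3] k].
have ev p q r p' q' r' a0 a1 a2 a3 :
    (cup2 (f p q r) (f p' q' r') (T a0 a1 a2 a3) : F) =
    polar_pfaffian (quad_mx J p q r) (quad_mx J p' q' r') (nth a0 [:: a0; a1; a2; a3]).
  rewrite cup2_form_of_mx ?quad_mx_skew // /polar_pfaffian !ffunE !inordK //.
have V0 p q r p' q' r' : (cup2 (f p q r) (f p' q' r') (T (x 0) (x 1) (x 2) (x 3)) : F)
    = 2%:R * p * p'.
  by rewrite ev /polar_pfaffian /= ?(xx, xy, yx, yy) !JE //=; ring.
have V1 p q r p' q' r' : (cup2 (f p q r) (f p' q' r') (T (x 0) (x 1) (x 2) (y 3)) : F)
    = p * q' + q * p'.
  by rewrite ev /polar_pfaffian /= ?(xx, xy, yx, yy) !JE //=; ring.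
have V2 p q r p' q' r' : (cup2 (f p q r) (f p' q' r') (T (x 0) (x 1) (y 2) (y 3)) : F)
    = p * r' + r * p'.
  by rewrite ev /polar_pfaffian /= ?(xx, xy, yx, yy) !JE //=; ring.
have V3 p q r p' q' r' : (cup2 (f p q r) (f p' q' r') (T (x 0) (x 1) (y 0) (y 1)) : F)
    = p * r' + r * p' - 2%:R * q * q'.
  by rewrite ev /polar_pfaffian /= ?(xx, xy, yx, yy) !JE //=; ring.
have V4 p q r p' q' r' : (cup2 (f p q r) (f p' q' r') (T (x 2) (y 3) (y 0) (y 1)) : F)
    = q * r' + r * q'.
  by rewrite ev /polar_pfaffian /= ?(xx, xy, yx, yy) !JE //=; ring.
have V5 p q r p' q' r' : (cup2 (f p q r) (f p' q' r') (T (y 0) (y 1) (y 2) (y 3)) : F)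
    = 2%:R * r * r'.
  by rewrite ev /polar_pfaffian /= ?(xx, xy, yx, yy) !JE //=; ring.
have sum0 t : c (inord 0) * (cup2 (f 1 0 0) (f 1 0 0) t : F)
   + c (inord 1) * (cup2 (f 1 0 0) (f 0 1 0) t : F)
   + c (inord 2) * (cup2 (f 1 0 0) (f 0 0 1) t : F)
   + c (inord 3) * (cup2 (f 0 1 0) (f 0 1 0) t : F)
   + c (inord 4) * (cup2 (f 0 1 0) (f 0 0 1) t : F)
   + c (inord 5) * (cup2 (f 0 0 1) (f 0 0 1) t : F) = 0.
  have := congr1 (fun w : kform F 4 (4 + 4) => (w t : F)) c0; rewrite /= form0E.
  apply: etrans; rewrite !big_ord_recl big_ord0 addr0 !(formDE, formZE) !addrA.
  rewrite /sq_basis /=; do 5?[congr (_ + _)]; congr (c _ * _);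
  by apply: val_inj; rewrite /= inordK.
(* The tuples detect, in turn, the products in degrees (4,0), (3,1), (2,2)
   twice, (1,3) and (0,4). *)
have E0 := sum0 (T (x 0) (x 1) (x 2) (x 3)); rewrite !V0 in E0.
have E1 := sum0 (T (x 0) (x 1) (x 2) (y 3)); rewrite !V1 in E1.
have E2 := sum0 (T (x 0) (x 1) (y 2) (y 3)); rewrite !V2 in E2.
have E3 := sum0 (T (x 0) (x 1) (y 0) (y 1)); rewrite !V3 in E3.
have E4 := sum0 (T (x 2) (y 3) (y 0) (y 1)); rewrite !V4 in E4.
have E5 := sum0 (T (y 0) (y 1) (y 2) (y 3)); rewrite !V5 in E5.
have two0 : 2%:R != 0 :> F by rewrite pnatr_eq0.
have z2 (a b : F) : 2%:R * a = b -> b = 0 -> a = 0.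
  by move=> <- /eqP; rewrite mulf_eq0 (negPf two0) => /eqP.
have c5 : c (inord 5) = 0 by apply: (z2 _ _ _ E5); ring.
have c4 : c (inord 4) = 0 by rewrite -[RHS]E4; ring.
have c2 : c (inord 2) = 0 by rewrite -[RHS]E2; ring.
have c3 : c (inord 3) = 0.
  apply: (z2 _ (c (inord 2) - 0)); last by rewrite c2 subr0.
  by rewrite -[X in _ - X]E3; ring.
have c1 : c (inord 1) = 0 by rewrite -[RHS]E1; ring.
have c00 : c (inord 0) = 0 by apply: (z2 _ _ _ E0); ring.
move=> j; rewrite -(inord_val j).
by case: j => [[|[|[|[|[|[|//]]]]]] ?].
Qed.
Lemma sq_basis_free_of (D M : 'M[F]_4) (e0 e1 e2 : kform F 2 (4 + 4)) :
  D \in unitmx ->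
  M = hyperbolic_mx (row (inord 0) D) (row (inord 1) D)
                    (row (inord 2) D) (row (inord 3) D) ->
  e0 = form_of_mx (quad_mx M 1 0 0) -> e1 = form_of_mx (quad_mx M 0 1 0) ->
  e2 = form_of_mx (quad_mx M 0 0 1) ->
  forall c : 'I_6 -> F,
    \sum_j c j *: sq_basis e0 e1 e2 j = 0 -> forall j, c j = 0.
Proof. by move=> uD -> -> -> ->; apply: sq_basis_free. Qed.
End Squares.

(** * The three basic classes of a polarization *)

Section Tori.
Variable R : realType.
Notation C := R[i].

(** The matrix of an integral alternating form on [H_1 (x) C]. *)
Definition polmx m (E : 'M[int]_m) : 'M[C]_m := toC (intR R E).

Lemma polmxE m (E : 'M[int]_m) i j : polmx E i j = (E i j)%:~R.
Proof. by rewrite !mxE rmorph_int. Qed.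

Lemma polmx_skew m (E : 'M[int]_m) : E^T = - E -> (polmx E)^T = - polmx E.
Proof.
move/matrixP => skE; apply/matrixP => i j; have := skE i j.
by rewrite !mxE => ->; rewrite !rmorphN.
Qed.

Section Bases.
Variables (dt : 'M[rat]_4) (E : 'M[int]_4).
Hypothesis hdt : symplectic_basis R dt E.

Let rw k : 'rV[C]_4 := map_mx ratr (row (inord k) dt).

Lemma polmx_basis : polmx E = hyperbolic_mx (rw 0) (rw 1) (rw 2) (rw 3).
Proof.
case: hdt => _ hE; apply: (@form_of_mx_inj C 4); etransitivity; first exact: hE.
exact: wedge_hyperbolic.
Qed.

Lemma omega1E : omega1 R dt = form_of_mx (quad_mx (polmx E) 1 0 0).
Proof. by rewrite polmx_basis -pr1_form; exact: pull_hyperbolic. Qed.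

Lemma omega2E : omega2 R dt = form_of_mx (quad_mx (polmx E) 0 0 1).
Proof. by rewrite polmx_basis -pr2_form; exact: pull_hyperbolic. Qed.

Lemma omegaSE : omegaS R dt = form_of_mx (quad_mx (polmx E) 0 1 0).
Proof. by rewrite polmx_basis; exact: mixed_hyperbolic. Qed.
End Bases.

End Tori.

(** * Hodge classes *)

Section HodgeClasses.
Variable R : realType.
Notation C := R[i].

Lemma mulC_conj (z : C) :
  z * z^* = real_complex R (complex.Re z ^+ 2 + complex.Im z ^+ 2).
Proof.
case: z => a b; apply/eqP; rewrite eq_complex /=; apply/andP; split; apply/eqP; ring.
Qed.

(** The polarization is of type (1,1). *)
Lemma polmx_hodge m (T : ctorus R m) (E : 'M[int]_m) (z : C) : neron_severi T E ->
  (hodge_mx T z)^T *m polmx R E *m hodge_mx T z = (z * z^*) *: polmx R E.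
Proof.
case=> _ EI; rewrite /hodge_mx /polmx /toC map_trmx -!map_mxM mulC_conj -map_mxZ.
congr map_mx; move: (complex.Re z) (complex.Im z) => a b.
have IE : (cplx T)^T *m intR R E = - (intR R E *m cplx T).
  rewrite -[in RHS]EI -!mulmxA cplx_sqr !mulmxN !mulmx1 opprK //.
have EII : intR R E *m cplx T *m cplx T = - intR R E.
  by rewrite -mulmxA cplx_sqr mulmxN mulmx1.
rewrite [(_ + _)^T]linearD /= [(_ *: _)^T]linearZ /= tr_scalar_mx mulmxDl.
rewrite mul_scalar_mx -scalemxAl IE.
rewrite mulmxDr mul_mx_scalar -scalemxAr mulmxDl -scalemxAl -scalemxAl mulNmx EII opprK.
by apply/matrixP => i j; rewrite !mxE; ring.
Qed.

Lemma hodge_mx_prod m (T : ctorus R m) (z : C) :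
  hodge_mx (prodT T T) z = block_mx (hodge_mx T z) 0 0 (hodge_mx T z).
Proof.
rewrite /hodge_mx /toC /= scalar_mx_block scale_block_mx add_block_mx !scaler0 !addr0.
by rewrite map_block_mx map_mx0.
Qed.

Lemma hodge_typeD m (T : ctorus R m) p q k (a b : kform C k m) :
  hodge_type T p q a -> hodge_type T p q b -> hodge_type T p q (a + b).
Proof. by move=> ha hb z; rewrite pullD ha hb scalerDr. Qed.

Lemma hodge_typeZ m (T : ctorus R m) p q k c (a : kform C k m) :
  hodge_type T p q a -> hodge_type T p q (c *: a).
Proof. by move=> ha z; rewrite pullZ ha !scalerA mulrC. Qed.

Lemma hodge_type_cup2 m (T : ctorus R m) (a b : kform C 2 m) :
  hodge_type T 1 1 a -> hodge_type T 1 1 b -> hodge_type T 2 2 (cup2 a b).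
Proof.
move=> ha hb z; rewrite pull_cup2 ha hb cup2Zl cup2Zr scalerA; congr (_ *: _).
by rewrite !expr1 !expr2 mulrACA.
Qed.

(** Rational complex numbers. *)
Definition is_ratr (x : C) : Prop := exists r : rat, x = ratr r.

Lemma is_ratrD x y : is_ratr x -> is_ratr y -> is_ratr (x + y).
Proof. by case=> r -> [s ->]; exists (r + s); rewrite rmorphD. Qed.

Lemma is_ratrM x y : is_ratr x -> is_ratr y -> is_ratr (x * y).
Proof. by case=> r -> [s ->]; exists (r * s); rewrite rmorphM. Qed.

Lemma is_ratr_nat n : is_ratr n%:R.
Proof. by exists n%:R; rewrite rmorph_nat. Qed.

Lemma is_ratr0 : is_ratr 0.
Proof. by exists 0; rewrite rmorph0. Qed.

Lemma is_ratr1 : is_ratr 1.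
Proof. by exists 1; rewrite rmorph1. Qed.

Lemma is_ratr_int n : is_ratr n%:~R.
Proof. by exists n%:~R; rewrite rmorph_int. Qed.

Lemma is_ratr_sum (I : finType) (f : I -> C) :
  (forall i, is_ratr (f i)) -> is_ratr (\sum_i f i).
Proof.
move=> hf; apply: big_ind => //; [exact: (is_ratr_nat 0) | exact: is_ratrD].
Qed.

Lemma rationalD k m (a b : kform C k m) :
  Defs.rational a -> Defs.rational b -> Defs.rational (a + b).
Proof. by move=> ha hb t; rewrite formDE; apply: is_ratrD; [apply: ha | apply: hb]. Qed.

Lemma rationalZ k m c (a : kform C k m) :
  is_ratr c -> Defs.rational a -> Defs.rational (c *: a).
Proof. by move=> hc ha t; rewrite formZE; apply: is_ratrM => //; apply: ha. Qed.

Lemma rational_wedge p q m (a : kform C p m) (b : kform C q m) :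
  Defs.rational a -> Defs.rational b -> Defs.rational (wedge a b).
Proof.
move=> ha hb t; rewrite wedgeE; apply: is_ratrM.
  by exists (p`! * q`!)%:R^-1; rewrite fmorphV rmorph_nat.
apply: is_ratr_sum => s; apply: is_ratrM.
  by exists ((-1) ^+ s); rewrite rmorphXn rmorphN1.
by apply: is_ratrM; [apply: ha | apply: hb].
Qed.

Lemma hodge_classD m (T : ctorus R m) p (a b : kform C (2 * p) m) :
  hodge_class T a -> hodge_class T b -> hodge_class T (a + b).
Proof.
case=> ? ? ? [? ? ?].
by split; [exact: alternatingD | exact: rationalD | exact: hodge_typeD].
Qed.

Lemma hodge_classZ m (T : ctorus R m) p c (a : kform C (2 * p) m) :
  is_ratr c -> hodge_class T a -> hodge_class T (c *: a).
Proof.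
move=> hc [? ? ?].
by split; [exact: alternatingZ | exact: rationalZ | exact: hodge_typeZ].
Qed.

Section Square.
Variables (m : nat) (T : ctorus R m) (E : 'M[int]_m).
Hypothesis hE : neron_severi T E.

Lemma quad_hodge p q r :
  hodge_type (prodT T T) 1 1 (form_of_mx (quad_mx (polmx R E) p q r)).
Proof.
move=> z; rewrite hodge_mx_prod pull_quad_diag polmx_hodge // -form_of_mxZ !expr1.
by rewrite /quad_mx scale_block_mx !scalerA ![_ * (z * _)]mulrC.
Qed.

Lemma quad_rational p q r : is_ratr p -> is_ratr q -> is_ratr r ->
  Defs.rational (form_of_mx (quad_mx (polmx R E) p q r)).
Proof.
move=> hp hq hr t; rewrite form_of_mxE.
have blk c i j : is_ratr c -> is_ratr ((c *: polmx R E) i j).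
  by move=> hc; rewrite mxE polmxE; apply: is_ratrM => //; exact: is_ratr_int.
move: (t ord0) (t ord_max) => i j; rewrite -(splitK i) -(splitK j).
case: (split i) => i'; case: (split j) => j' /=;
by rewrite /quad_mx ?block_mxEul ?block_mxEur ?block_mxEdl ?block_mxEdr; apply: blk.
Qed.
End Square.

Lemma cup2_hodge_class m (T : ctorus R m) (a b : kform C 2 m) :
  Defs.rational a -> hodge_type T 1 1 a -> Defs.rational b -> hodge_type T 1 1 b ->
  hodge_class T (p := 2) (cup2 a b).
Proof.
move=> ra ta rb tb; split; first exact: cup2_alternating.
  exact: (rational_wedge ra rb).
exact: hodge_type_cup2.
Qed.
End HodgeClasses.

(** * The class of a point *)

Lemma col_row_mx4 (F : Type) k (a b c d : 'M[F]_(k, 1)) :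
  let X : 'M_(k, 4) := row_mx (row_mx a b) (row_mx c d) in
  [/\ col (inord 0) X = a, col (inord 1) X = b, col (inord 2) X = c
    & col (inord 3) X = d].
Proof.
pose o : 'I_1 := ord0.
have e0 : inord 0 = lshift (1 + 1) (lshift 1 o) :> 'I_4.
  by apply: val_inj; rewrite /= inordK.
have e1 : inord 1 = lshift (1 + 1) (rshift 1 o) :> 'I_4.
  by apply: val_inj; rewrite /= inordK.
have e2 : inord 2 = rshift (1 + 1) (lshift 1 o) :> 'I_4.
  by apply: val_inj; rewrite /= inordK.
have e3 : inord 3 = rshift (1 + 1) (rshift 1 o) :> 'I_4.
  by apply: val_inj; rewrite /= inordK.
move=> X; split; apply/matrixP => i j; rewrite mxE [j]ord1 ?e0 ?e1 ?e2 ?e3 /X.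
- exact: (etrans (row_mxEl _ _ i (lshift 1 o)) (row_mxEl a b i o)).
- exact: (etrans (row_mxEl _ _ i (rshift 1 o)) (row_mxEr a b i o)).
- exact: (etrans (row_mxEr _ _ i (lshift 1 o)) (row_mxEl c d i o)).
- exact: (etrans (row_mxEr _ _ i (rshift 1 o)) (row_mxEr c d i o)).
Qed.

Section PointClasses.
Variable R : realType.
Notation C := R[i].

(** [omega^2 / 2], for the form [omega] with matrix [M]. *)
Definition half_square m (M : 'M[C]_m) : kform C 4 m :=
  2%:R^-1 *: cup2 (form_of_mx M) (form_of_mx M).

Lemma half_squareN m (M : 'M[C]_m) : half_square (- M) = half_square M.
Proof.
rewrite /half_square -scaleN1r form_of_mxZ cup2Zl cup2Zr scalerA.
by rewrite mulrNN mulr1 scale1r.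
Qed.

Lemma pull_half_square m m' (A : 'M[C]_(m', m)) (M : 'M[C]_m') :
  pull A (half_square M) = half_square (A^T *m M *m A).
Proof. by rewrite /half_square pullZ pull_cup2 pull_form_of_mx. Qed.

Lemma half_square_alternating m (M : 'M[C]_m) : alternating (half_square M).
Proof. by apply: alternatingZ; exact: cup2_alternating. Qed.

Lemma polmxM m (A B : 'M[int]_m) : polmx R (A *m B) = polmx R A *m polmx R B.
Proof. by rewrite /polmx /intR /toC !map_mxM. Qed.

Lemma polmxT m (A : 'M[int]_m) : polmx R A^T = (polmx R A)^T.
Proof. by rewrite /polmx /intR /toC !map_trmx. Qed.

(** For a unimodular [E], half the square of the form is [1] or [-1] on the
    standard basis, as the point class is. *)
Lemma half_square_top (E : 'M[int]_4) (c : kform C 4 4) :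
  E^T = - E -> E \in unitmx -> alternating c ->
  c [ffun i => i] = 1 \/ c [ffun i => i] = -1 ->
  exists e : bool, c = (-1) ^+ e *: half_square (polmx R E).
Proof.
move=> skE uE altc c1.
have [e pfE] := polar_pfaffian_unimodular skE uE.
have hs1 : (half_square (polmx R E) [ffun i => i] : C) = (-1) ^+ e.
  rewrite formZE cup2_form_of_mx ?polmx_skew //.
  have -> : polar_pfaffian (polmx R E) (polmx R E) (fun k => [ffun i => i] (inord k)) =
      (polar_pfaffian E E inord)%:~R.
    by rewrite /polar_pfaffian !ffunE !polmxE !(rmorphD, rmorphN, rmorphM).
  by rewrite pfE rmorphM rmorph_sign rmorph_nat mulKf // pnatr_eq0.
case: c1 => c1; [exists e | exists (~~ e)]; apply: alternating_top => //;
  try exact/alternatingZ/half_square_alternating.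
  by rewrite formZE hs1 -signr_addb addbb c1.
by rewrite formZE hs1 -signr_addb c1; case: (e).
Qed.

Section Positivity.
Variables (J : ctorus R 4) (E : 'M[int]_4).
Hypothesis hE : principal_polarization J E.

Let ER := intR R E.
Let I := cplx J.

(** The real frame of the complex vectors [v], [w]. *)
Definition frame (v w : 'cV[R]_4) : 'M[R]_(4, (1 + 1) + (1 + 1)) :=
  row_mx (row_mx v (I *m v)) (row_mx w (I *m w)).

Lemma bil_skew x y : bil ER x y = - bil ER y x.
Proof.
have skE : ER^T = - ER.
  case: hE => -[skE _] _ _; apply/matrixP => i j; have /matrixP/(_ i j) := skE.
  by rewrite !mxE => ->; rewrite rmorphN.
have tr11 (A : 'M[R]_1) : A 0 0 = A^T 0 0 by rewrite mxE.
by rewrite /bil tr11 !trmx_mul trmxK skE mulNmx mulmxN mulmxA mxE.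
Qed.

Lemma bil_cplx x y : bil ER (I *m x) (I *m y) = bil ER x y.
Proof.
case: hE => -[_ EI] _ _; rewrite /bil trmx_mul -[ER in RHS]EI.
by rewrite !mulmxA.
Qed.

Lemma intR_cplx : I^T *m ER = - (ER *m I).
Proof.
case: hE => -[_ EI] _ _.
by rewrite -[ER in RHS]EI -!mulmxA cplx_sqr !mulmxN !mulmx1 opprK.
Qed.

(** On a frame [v, I v, w, I w] with the second complex line orthogonal to the
    first, the half square is [E(v, I v) E(w, I w)], a product of two negative
    numbers. *)
Lemma frame_positive : exists v w,
  0 < (pull (toC (frame v w)) (half_square (polmx R E)) : kform C 4 4) [ffun i => i].
Proof.
case: (hE) => _ _ posE.
pose v : 'cV[R]_4 := delta_mx 0 0.
have nzv : v != 0.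
  by apply/eqP => /matrixP/(_ 0 0)/eqP; rewrite !mxE !eqxx oner_eq0.
(* [w] is orthogonal to [v] and [I v]: two linear conditions in dimension 4. *)
pose A := col_mx (v^T *m ER) ((I *m v)^T *m ER).
have /rowV0Pn[u /sub_kermxP uA nzu] : kermx A^T != 0.
  rewrite kermx_eq0 /row_free neq_ltn (leq_ltn_trans (rank_leq_col _)) //.
pose w := u^T.
have nzw : w != 0 by rewrite trmx_eq0.
have Aw : A *m w = 0 by rewrite -[A]trmxK -trmx_mul uA trmx0.
have [vw Ivw] : bil ER v w = 0 /\ bil ER (I *m v) w = 0.
  rewrite /bil; have := Aw; rewrite mul_col_mx => Aw'.
  have := congr1 usubmx Aw'; have := congr1 dsubmx Aw'.
  by rewrite col_mxKd col_mxKu !linear0 => -> ->; rewrite !mxE.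
exists v, w; rewrite pull_half_square /half_square formZE.
pose M := (frame v w)^T *m ER *m frame v w.
have ME : (toC (frame v w))^T *m polmx R E *m toC (frame v w) = toC M.
  by rewrite /toC /M !map_mxM map_trmx.
have skM : (toC M)^T = - toC M.
  by rewrite -ME; apply: congruence_skew; apply: polmx_skew; case: (hE) => -[].
rewrite ME cup2_form_of_mx //.
have {}ME i j :
    toC M i j = real_complex R (bil ER (col i (frame v w)) (col j (frame v w))).
  rewrite mxE; congr real_complex_def; rewrite /M /bil !mxE; apply: eq_bigr => k _.
  rewrite !mxE; congr (_ * _); apply: eq_bigr => l _; by rewrite !mxE.
have [c0 c1 c2 c3] := col_row_mx4 v (I *m v) w (I *m w).
have IvIw : bil ER (I *m v) (I *m w) = 0 by rewrite bil_cplx.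
have vIw : bil ER v (I *m w) = 0.
  rewrite -bil_cplx mulmxA cplx_sqr mulNmx mul1mx /bil mulmxN mxE.
  by rewrite -/(bil ER (I *m v) w) Ivw oppr0.
rewrite /polar_pfaffian !ffunE !ME /frame c0 c1 c2 c3 vw Ivw vIw IvIw.
rewrite rmorph0 !(mul0r, mulr0) subr0 !addr0 subr0 [X in _ + X]mulrC -mulr2n.
rewrite -[X in _ * X]mulr_natl mulKf ?pnatr_eq0 // -rmorphM ltcR.
by rewrite (bil_skew v) (bil_skew w) mulrNN mulr_gt0 // posE.
Qed.

Lemma positive_half_square (e : bool) (c : kform C 4 4) :
  c = (-1) ^+ e *: half_square (polmx R E) ->
  (forall v w, 0 <= (pull (toC (frame v w)) c : kform C 4 4) [ffun i => i]) ->
  c = half_square (polmx R E).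
Proof.
move=> ->; case: e => c_ge0; last by rewrite expr0 scale1r.
have [v [w pos]] := frame_positive.
have := c_ge0 v w; rewrite pullZ formZE expr1 mulN1r oppr_ge0.
by rewrite lt_geF.
Qed.

Lemma point_class_half_square (c : kform C 4 4) :
  point_class J c -> c = half_square (polmx R E).
Proof.
case=> altc c1 posc; case: (hE) => -[skE _] uE _.
have [e ce] := half_square_top skE uE altc c1.
exact: positive_half_square ce posc.
Qed.

(** The polarization identifies the point class of the dual torus with that
    of the torus. *)
Lemma dual_point_class_half_square (c : kform C 4 4) :
  point_class (dualT J) c -> pull (polmx R E) c = half_square (polmx R E).
Proof.
case=> altc c1 posc; case: (hE) => -[skE _] uE _.
have skE' : (invmx E)^T = - invmx E.
  rewrite -[LHS]mulmx1 -(mulmxV uE) mulmxA -[X in _ *m X *m _]opprK -skE mulmxN.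
  by rewrite -trmx_mul mulmxV // trmx1 mulNmx mul1mx.
have uE' : invmx E \in unitmx by rewrite unitmx_inv.
(* The inverse matrix is unimodular on the dual lattice, and its pullback by [E]
   is [- E]. *)
have [e ce] := half_square_top skE' uE' altc c1.
have EE : (polmx R E)^T *m polmx R (invmx E) *m polmx R E = - polmx R E.
  rewrite -(polmxT E) -(polmxM E^T (invmx E)) -(polmxM _ E) -mulmxA mulVmx // mulmx1.
  by rewrite polmxT polmx_skew.
apply: (@positive_half_square e).
  rewrite ce pullZ pull_half_square EE half_squareN; reflexivity.
move=> v w; rewrite pull_comp.
have -> : polmx R E *m toC (frame v w) = toC (row_mx
    (row_mx (ER *m v) (cplx (dualT J) *m (ER *m v)))
    (row_mx (ER *m w) (cplx (dualT J) *m (ER *m w)))).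
  rewrite /polmx /toC -map_mxM /frame !mul_mx_row; congr map_mx.
  by rewrite /= !mulmxA !mulNmx -/I intR_cplx !mulNmx !opprK.
exact: posc.
Qed.
End Positivity.
End PointClasses.

(** * The Poincare bundle and the Cayley class *)

Lemma halve_squares (F : numFieldType) (V : lmodType F) (n : F) (x y z : V) :
  - n *: x + (4%:R * n ^+ 2) *: (2%:R^-1 *: y) + 4%:R *: (2%:R^-1 *: z) =
  - n *: x + (2%:R * n ^+ 2) *: y + 2%:R *: z.
Proof.
by rewrite !scalerA; congr (_ + _ *: _ + _ *: _); field.
Qed.

Lemma cup2_oppr (F : numFieldType) m (a : kform F 2 m) :
  cup2 (-1 *: a) (-1 *: a) = cup2 a a.
Proof. by rewrite cup2Zl cup2Zr scalerA mulrNN mulr1 scale1r. Qed.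

Section Poincare.
Variable R : realType.
Notation C := R[i].

(* Testing with [t = 1 / (2 d)] would make [1 / 2] an integer. *)
Lemma real_multiples_int (d : int) :
  (forall t : R, t * d%:~R \is a Num.int) -> d = 0.
Proof.
move=> hd; apply/eqP/negPn/negP => nzd.
have nzd' : d%:~R != 0 :> R by rewrite intr_eq0.
have /intrP[k] := hd (2%:R^-1 / d%:~R).
rewrite divfK // => /(congr1 (fun x => 2%:R * x)).
rewrite mulfV ?pnatr_eq0 // -[2%:R]/(2%:~R) -intrM => /eqP.
by rewrite -[1]/(1%:~R) eqr_int => /eqP; lia.
Qed.

Lemma bil_delta m (M : 'M[R]_m) i j (t : R) :
  bil M (t *: delta_mx i 0) (delta_mx j 0) = t * M i j.
Proof.
rewrite /bil linearZ /= trmx_delta -!scalemxAl -rowE -colE !mxE //.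
Qed.

Section Bundle.
Variables (T : ctorus R 4) (P : line_bundle (prodT T (dualT T))).
Hypothesis hP : normalized_poincare P.

(** The normalization determines the first Chern class: the restrictions to the
    two factors vanish, and translating by [(0, f)] multiplies the character by
    [exp (2 i pi E ((0, f), -))], which must be [exp (2 i pi f)]. *)
Lemma poincare_mx : lb_E P = block_mx 0 (- 1%:M) 1%:M 0.
Proof.
case: hP => ul trans dr _; have [skP _] := lb_NS P.
have dl : dlsubmx (lb_E P) = 1%:M.
  apply/matrixP => i j; apply/eqP; rewrite -subr_eq0; apply/eqP.
  apply: real_multiples_int => t.
  pose x : 'cV[int]_4 := delta_mx j 0.
  have xR : intR R x = delta_mx j 0 by apply/matrixP => a b; rewrite !mxE mulrz_nat.
  have bilE (f : 'cV[R]_4) : bil (intR R (lb_E P)) (col_mx 0 f) (intR R (col_mx x 0)) =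
      bil (intR R (dlsubmx (lb_E P))) f (intR R x).
    rewrite /bil -[in LHS](submxK (lb_E P)) /intR map_block_mx map_col_mx map_mx0.
    rewrite tr_col_mx trmx0 mul_row_block mul_row_col.
    by rewrite !(mul0mx, mulmx0, add0r, addr0).
  have E1 (s : R) : eqmodZ (lb_chi P (col_mx x 0) + s * (dlsubmx (lb_E P) i j)%:~R)
      (s * (i == j)%:R).
    have := trans (s *: delta_mx i 0) x; rewrite bilE xR bil_delta.
    have -> (f y : 'cV[R]_4) : (f^T *m y) 0 0 = bil 1%:M f y by rewrite /bil mulmx1.
    by rewrite bil_delta [1%:M i j]mxE [intR R _ i j]mxE.
  have -> : (1%:M : 'M[int]_4) i j = (i == j)%:R by rewrite mxE.
  have := rpredB (E1 t) (E1 0); move: (dlsubmx _ i j) => d; move: (lb_chi _ _) => a.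
  move=> hz; rewrite (_ : t * _ = a + t * d%:~R - t * (i == j)%:R
    - (a + 0 * d%:~R - 0 * (i == j)%:R)) //.
  by rewrite intrD mulrNz mulrz_nat; ring.
rewrite -[LHS]submxK ul dr dl; congr block_mx.
rewrite -[LHS]trmxK trmx_ursub skP (_ : dlsubmx (- lb_E P) = - 1%:M).
  by rewrite linearN /= trmx1.
by rewrite -dl; apply/matrixP => i j; rewrite !mxE.
Qed.

Lemma poincare_polmx : polmx R (lb_E P) = block_mx 0 (- 1%:M) 1%:M 0.
Proof.
rewrite poincare_mx /polmx /intR /toC !map_block_mx !map_mx0.
by rewrite !map_mxN !map_mx1.
Qed.
End Bundle.

Lemma ident_mx m (E : 'M[int]_m) : ident R E = block_mx 1%:M 0 0 (polmx R E).
Proof.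
by rewrite /ident /polmx /intR /toC !map_block_mx !map_mx0 !map_mx1.
Qed.

Lemma poincare_pullback (F : fieldType) m (M : 'M[F]_m) : M^T = - M ->
  (block_mx 1%:M 0 0 M)^T *m block_mx 0 (- 1%:M) 1%:M 0 *m block_mx 1%:M 0 0 M =
  quad_mx (- M) 0 1 0.
Proof.
move=> skM; rewrite tr_block_mx !trmx0 trmx1 !mulmx_block skM.
rewrite !(mul0mx, mulmx0, mul1mx, mulmx1, addr0, add0r, mulNmx, mulmxN).
by rewrite /quad_mx !scale0r !scale1r.
Qed.

Variables (J : ctorus R 4) (E : 'M[int]_4).
Hypothesis hE : principal_polarization J E.
Variable P : line_bundle (prodT J (dualT J)).
Hypothesis hP : normalized_poincare P.
Variables ptJ ptJhat : kform C 4 4.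
Hypothesis (hptJ : point_class J ptJ) (hptJhat : point_class (dualT J) ptJhat).

Local Notation e p q r := (form_of_mx (quad_mx (polmx R E) p q r)).

Lemma polmx_sk : (polmx R E)^T = - polmx R E.
Proof. by apply: polmx_skew; case: hE => -[]. Qed.

(** Under the identification, the Poincare class is [- omega_sigma]. *)
Lemma pull_c1 : pull (ident R E) (c1 P) = -1 *: e 0 1 0.
Proof.
rewrite /c1 -/(polmx R (lb_E P)) poincare_polmx // ident_mx pull_form_of_mx.
rewrite poincare_pullback ?polmx_sk // -form_of_mxZ; congr form_of_mx.
by rewrite /quad_mx scale_block_mx !scale0r !scaler0 !scale1r scaleN1r.
Qed.

Lemma pull_point1 : pull (ident R E) (pull (pr1 C 4 4) ptJ) =
  2%:R^-1 *: cup2 (e 1 0 0) (e 1 0 0).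
Proof.
rewrite pull_comp ident_mx.
have -> : pr1 C 4 4 *m block_mx 1%:M 0 0 (polmx R E) = pr1 C 4 4.
  by rewrite /pr1 mul_row_block !(mul0mx, mulmx0, mulmx1, addr0).
rewrite (point_class_half_square hE hptJ) /half_square pullZ pull_cup2 pr1_form.
reflexivity.
Qed.

Lemma pull_point2 : pull (ident R E) (pull (pr2 C 4 4) ptJhat) =
  2%:R^-1 *: cup2 (e 0 0 1) (e 0 0 1).
Proof.
rewrite pull_comp ident_mx.
have -> : pr2 C 4 4 *m block_mx 1%:M 0 0 (polmx R E) = polmx R E *m pr2 C 4 4.
  rewrite /pr2 mul_row_block mul_mx_row.
  by rewrite !(mul0mx, mulmx0, mulmx1, mul1mx, addr0, add0r).
rewrite -pull_comp (dual_point_class_half_square hE hptJhat).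
rewrite /half_square pullZ pull_cup2 pr2_form.
reflexivity.
Qed.

Lemma cayley_class_of_pullbacks n (e0 e1 e2 : kform C 2 (4 + 4)) :
  pull (ident R E) (c1 P) = -1 *: e1 ->
  pull (ident R E) (pull (pr1 C 4 4) ptJ) = 2%:R^-1 *: cup2 e0 e0 ->
  pull (ident R E) (pull (pr2 C 4 4) ptJhat) = 2%:R^-1 *: cup2 e2 e2 ->
  cayley_class E P ptJ ptJhat n =
  n%:R *: (- n%:R *: cup2 e1 e1 + (2%:R * n%:R ^+ 2) *: cup2 e0 e0
     + 2%:R *: cup2 e2 e2).
Proof.
move=> E1 E0 E2; rewrite /cayley_class pullZ !pullD !pullZ pull_cup2 E1 E0 E2.
rewrite cup2_oppr; move: (cup2 e1 e1) (cup2 e0 e0) (cup2 e2 e2) => x y z.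
exact: (congr1 (fun w => n%:R *: w) (halve_squares n%:R x y z)).
Qed.

End Poincare.

(** * Cartan algebras and their planes *)

Section CartanAlgebra.
Variable F : fieldType.

Lemma unitmx_cols (v w : 'cV[F]_2) :
  (row_mx v w \in unitmx) = (v 0 0 * w 1 0 - v 1 0 * w 0 0 != 0).
Proof.
pose X : 'M_2 := row_mx v w.
pose G l := X 0 (inord (nth 0%N l 0)) * X 1 (inord (nth 0%N l 1)).
have l1 : lift 0 0 = 1 :> 'I_2 by apply: val_inj.
have i0 : inord 0 = 0 :> 'I_2 by apply: val_inj; rewrite /= inordK.
have i1 : inord 1 = 1 :> 'I_2 by apply: val_inj; rewrite /= inordK.
have X0 i : X i 0 = v i 0.
  by have := row_mxEl v w i (0 : 'I_1); congr (X _ _ = _); apply: val_inj.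
have X1 i : X i 1 = w i 0.
  by have := row_mxEr v w i (0 : 'I_1); congr (X _ _ = _); apply: val_inj.
rewrite unitmxE unitfE -/X /determinant.
rewrite (eq_bigr (fun s : 'S_2 => (-1) ^+ s * G (perm_vals s))); last first.
  move=> s _; rewrite !big_ord_recl big_ord0 mulr1 l1 /G.
  rewrite (nth_perm_vals s 0) (nth_perm_vals s 1) !inord_val //.
rewrite sum_perm_vals_alternating /alternating_sum /=.
rewrite !big_ord_recl !big_ord0 /= /bump /=.
rewrite /G /= i0 i1 !X0 !X1; congr (_ != 0); ring.
Qed.

(** Any basis of the plane is the eigenbasis of a split Cartan algebra, spanned
    by the identity and the projection to the first line along the second. *)
Lemma cartan_of_basis (v w : 'cV[F]_2) : v 0 0 * w 1 0 - v 1 0 * w 0 0 != 0 ->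
  exists K : {vspace 'M[F]_2},
    [/\ \dim K = 2, 1%:M \in K,
        forall a b, a \in K -> b \in K -> a *m b \in K &
        forall a, a \in K ->
          (exists l, a *m v = l *: v) /\ (exists l, a *m w = l *: w)].
Proof.
move=> nzD; set D := _ - _ in nzD.
(* [r] is the functional with [r v = 1] and [r w = 0]. *)
pose r : 'rV[F]_2 := \row_j (if j == 0 then w 1 0 / D else - w 0 0 / D).
have rv : r *m v = 1%:M.
  apply/matrixP => i j; rewrite !ord1 !mxE !big_ord_recl big_ord0 !mxE /=.
  have -> : lift 0 0 = 1 :> 'I_2 by apply: val_inj.
  rewrite addr0 [_ / _ * _]mulrAC [- _ / _ * _]mulrAC -mulrDl -[RHS](divff nzD).
  by congr (_ / _); rewrite /D; ring.
have rw : r *m w = 0.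
  apply/matrixP => i j; rewrite !ord1 !mxE !big_ord_recl big_ord0 !mxE /=.
  have -> : lift 0 0 = 1 :> 'I_2 by apply: val_inj.
  by field.
pose p := v *m r.
have pv : p *m v = v by rewrite -mulmxA rv mulmx1.
have pw : p *m w = 0 by rewrite -mulmxA rw mulmx0.
have pp : p *m p = p by rewrite {1}/p -mulmxA [r *m p]mulmxA rv mul1mx.
have nzv : v != 0.
  by apply: contra_neq nzD => v0; rewrite /D v0 !mxE !mul0r subr0.
have nzw : w != 0.
  by apply: contra_neq nzD => w0; rewrite /D w0 !mxE !mulr0 subr0.
have KP a : a \in <<[:: 1%:M; p]>>%VS -> exists x y, a = x *: 1%:M + y *: p.
  rewrite span_cons span_seq1 => /memv_addP[_ /vlineP[x ->] [_ /vlineP[y ->] ->]].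
  by exists x, y.
have memK x y : x *: 1%:M + y *: p \in <<[:: 1%:M; p]>>%VS.
  by rewrite rpredD // rpredZ // memv_span // !inE eqxx ?orbT.
exists <<[:: 1%:M; p]>>%VS; split.
- suff /eqnP : free [:: 1%:M; p] by [].
  rewrite free_cons seq1_free span_seq1; apply/andP; split.
    apply/negP => /vlineP[x E]; have := congr1 (mulmx^~ w) E.
    by rewrite mul1mx -scalemxAl pw scaler0 => w0; rewrite w0 eqxx in nzw.
  by apply: contra_neq nzv => p0; rewrite -pv p0 mul0mx.
- by rewrite memv_span // inE eqxx.
- move=> _ _ /KP[x [y ->]] /KP[x' [y' ->]].
  rewrite mulmxDl !mulmxDr -!scalemxAl -!scalemxAr !mul1mx mulmx1 pp !scalerA.
  have E2 (A B : 'M[F]_2) (a b c d : F) :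
      a *: A + b *: B + (c *: B + d *: B) = a *: A + (b + c + d) *: B.
    by rewrite !scalerDl !addrA.
  by rewrite E2 memK.
- move=> _ /KP[x [y ->]]; rewrite !mulmxDl -!scalemxAl !mul1mx pv pw.
  by split; [exists (x + y); rewrite scalerDl | exists x; rewrite scaler0 addr0].
Qed.
End CartanAlgebra.

Section PlanesOfForms.
Variables (F : numFieldType) (m : nat) (e0 e1 e2 : kform F 2 m).
Hypotheses (c01 : cup2 e0 e1 = cup2 e1 e0) (c02 : cup2 e0 e2 = cup2 e2 e0).
Hypothesis c12 : cup2 e1 e2 = cup2 e2 e1.

Let g := sq_basis e0 e1 e2.
Let quad p q r := p *: e0 + q *: e1 + r *: e2.

(** The plane of a Cartan algebra with eigenvectors [v], [w]. *)
Lemma plane_of_squares v0 v1 w0 w1 a b c :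
  let wK := quad (2%:R * v0 * w0) (v0 * w1 + w0 * v1) (2%:R * v1 * w1) in
  let wv := quad (v0 ^+ 2) (v0 * v1) (v1 ^+ 2) in
  let ww := quad (w0 ^+ 2) (w0 * w1) (w1 ^+ 2) in
  a *: cup2 wK wK + b *: cup2 wv wv + c *: cup2 ww ww =
  \sum_j plane_coef v0 v1 w0 w1 a b c j *: g j.
Proof.
move=> wK wv ww; rewrite /wK /wv /ww !cup2_sq // !scaler_sumr -!big_split /=.
by apply: eq_bigr => j _; rewrite !scalerA -!scalerDl.
Qed.

Lemma cayley_lincomb n :
  n *: (- n *: cup2 e1 e1 + (2%:R * n ^+ 2) *: cup2 e0 e0 + 2%:R *: cup2 e2 e2) =
  \sum_j cayley_coef n j *: g j.
Proof.
apply: formP => t; rewrite !big_ord_recl big_ord0 /cayley_coef /g /sq_basis /=.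
by rewrite !(formZE, formDE, form0E); ring.
Qed.

(** [(al - ga)^2 C_n], for [al ga = n], as a combination of three squares. *)
Lemma cayley_in_plane al ga :
  (al - ga) ^+ 2 *: (\sum_j cayley_coef (al * ga) j *: g j) =
  \sum_j plane_coef al 1 ga 1 (al * ga * - (al * ga)) (al * ga * (2%:R * ga ^+ 2))
    (al * ga * (2%:R * al ^+ 2)) j *: g j.
Proof.
rewrite scaler_sumr; apply: eq_bigr => j _; rewrite scalerA; congr (_ *: _).
rewrite /cayley_coef /plane_coef /sq_coef.
by case: j => [[|[|[|[|[|[|//]]]]]] ?] /=; ring.
Qed.
End PlanesOfForms.

(** * Assembling the planes in the space of Hodge classes *)

Section Subspace.
Variables (F : numFieldType) (V : vectType F) (U : {vspace V}) (g : 'I_6 -> V).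
Hypothesis gU : forall j, g j \in U.

Lemma vsval_lincomb (c : 'I_6 -> F) :
  vsval (\sum_j c j *: vsproj U (g j)) = \sum_j c j *: g j.
Proof.
by rewrite linear_sum; apply: eq_bigr => j _; rewrite linearZ /= vsprojK.
Qed.

Lemma vsproj_lincomb (c : 'I_6 -> F) :
  vsproj U (\sum_j c j *: g j) = \sum_j c j *: vsproj U (g j).
Proof. by rewrite linear_sum; apply: eq_bigr => j _; rewrite linearZ. Qed.

Lemma vsproj_free :
  (forall c : 'I_6 -> F, \sum_j c j *: g j = 0 -> forall j, c j = 0) ->
  forall c : 'I_6 -> F, \sum_j c j *: vsproj U (g j) = 0 -> forall j, c j = 0.
Proof. by move=> fg c c0; apply: fg; rewrite -vsval_lincomb c0 linear0. Qed.

Lemma memv_add3 (x a b c : V) :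
  x \in (<[a]> + <[b]> + <[c]>)%VS <-> exists k1 k2 k3, x = k1 *: a + k2 *: b + k3 *: c.
Proof.
split=> [|[k1 [k2 [k3 ->]]]]; last first.
  by rewrite !memv_add // memvZ // memv_line.
case/memv_addP => _ /memv_addP[_ /vlineP[k1 ->] [_ /vlineP[k2 ->] ->]].
by case=> _ /vlineP[k3 ->] ->; exists k1, k2, k3.
Qed.

Lemma memv_add3_of_multiple k l (x a b c : V) x1 x2 x3 : k != 0 ->
  k *: x = l *: (x1 *: a + x2 *: b + x3 *: c) ->
  x \in (<[a]> + <[b]> + <[c]>)%VS.
Proof.
move=> nzk kx; rewrite -[x](scalerK nzk) kx !rpredZ //.
by apply/memv_add3; exists x1, x2, x3.
Qed.
End Subspace.

Lemma col2E (F : Type) (a b : F) (v : 'cV[F]_2) :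
  v = \col_i (if i == 0 then a else b) -> (v 0 0 = a) * (v 1 0 = b).
Proof. by move=> ->; rewrite !mxE. Qed.

Lemma scale_sum3 (F : fieldType) (V : lmodType F) (k x y z : F) (a b c : V) :
  k *: (x *: a + y *: b + z *: c) = (k * x) *: a + (k * y) *: b + (k * z) *: c.
Proof. by rewrite !scalerDr !scalerA. Qed.

Section Main.
Variable R : realType.
Notation C := R[i].
Variables (J : ctorus R 4) (dt : 'M[rat]_4).

Let g := sq_basis (omega1 R dt) (omegaS R dt) (omega2 R dt).

Section Comm.
Hypothesis c01 : cup2 (omega1 R dt) (omegaS R dt) = cup2 (omegaS R dt) (omega1 R dt).
Hypothesis c02 : cup2 (omega1 R dt) (omega2 R dt) = cup2 (omega2 R dt) (omega1 R dt).
Hypothesis c12 : cup2 (omegaS R dt) (omega2 R dt) = cup2 (omega2 R dt) (omegaS R dt).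

Lemma BK_lincomb (v w : 'cV[C]_2) a b c :
  a *: cup2 (omegaK dt v w) (omegaK dt v w) + b *: cup2 (omegaV dt v) (omegaV dt v)
  + c *: cup2 (omegaV dt w) (omegaV dt w) =
  \sum_j plane_coef (v 0 0) (v 1 0) (w 0 0) (w 1 0) a b c j *: g j.
Proof. exact: (plane_of_squares c01 c02 c12). Qed.

(** Every pair of independent vectors is the eigenbasis of a Cartan algebra, so
    [Z] is the closure of all secant planes. *)
Lemma Zlocus_secant_planes :
  (forall j, g j \in BC (prodT J J) 2) ->
  Zlocus (J := J) dt =
  zclosure (secant_planes (fun j => vsproj (BC (prodT J J) 2) (g j))).
Proof.
move=> gU; rewrite /Zlocus; congr zclosure; apply/funext => x; apply/propext; split.
  case=> K [v [w [[_ _ _ uvw _] /memv_add3[a [b [c xE]]]]]].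
  exists (v 0 0), (v 1 0), (w 0 0), (w 1 0), a, b, c; split.
    by rewrite -unitmx_cols.
  apply: subvs_inj; apply: (etrans (etrans xE (BK_lincomb v w a b c))).
  exact: (esym (vsval_lincomb gU _)).
case=> v0 [v1 [w0 [w1 [a [b [c [D xE]]]]]]].
pose v : 'cV[C]_2 := \col_i (if i == 0 then v0 else v1).
pose w : 'cV[C]_2 := \col_i (if i == 0 then w0 else w1).
have vE := col2E (erefl v).
have wE := col2E (erefl w).
have D' : v 0 0 * w 1 0 - v 1 0 * w 0 0 != 0 by rewrite !vE !wE.
have [K [dK K1 KM Keig]] := cartan_of_basis D'.
exists K, v, w; split.
  split; [exact: dK | exact: K1 | exact: KM | by rewrite unitmx_cols |].
  move=> a' Ka'; have -> : map_mx id a' = a' by apply/matrixP => i j; rewrite mxE.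
  exact: (Keig a' Ka').
apply/memv_add3; exists a, b, c; apply: etrans.
  2: exact: (esym (BK_lincomb v w a b c)).
by rewrite !vE !wE xE; exact: (vsval_lincomb gU _).
Qed.
End Comm.

Variable E : 'M[int]_4.
Hypotheses (hE : principal_polarization J E) (hdt : symplectic_basis R dt E).

Lemma omega_comm :
  [/\ cup2 (omega1 R dt) (omegaS R dt) = cup2 (omegaS R dt) (omega1 R dt),
      cup2 (omega1 R dt) (omega2 R dt) = cup2 (omega2 R dt) (omega1 R dt) &
      cup2 (omegaS R dt) (omega2 R dt) = cup2 (omega2 R dt) (omegaS R dt)].
Proof.
have sk := quad_mx_skew _ _ _ (polmx_sk hE).
split; rewrite ?(omega1E hdt) ?(omega2E hdt) ?(omegaSE hdt);
by apply: cup2_comm; apply: sk.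
Qed.

Lemma omega_rational_hodge (w : kform C 2 (4 + 4)) :
  [\/ w = omega1 R dt, w = omegaS R dt | w = omega2 R dt] ->
  Defs.rational w /\ hodge_type (prodT J J) 1 1 w.
Proof.
have NS : neron_severi J E by case: hE.
by case=> ->; rewrite ?(omega1E hdt) ?(omega2E hdt) ?(omegaSE hdt); split;
  (exact: quad_hodge) || (apply: quad_rational; (exact: is_ratr0 || exact: is_ratr1)).
Qed.

Lemma sq_basis_hodge_class j : hodge_class (prodT J J) (p := 2) (g j).
Proof.
have [r1 t1] := omega_rational_hodge (Or31 _ _ (erefl _)).
have [rS tS] := omega_rational_hodge (Or32 _ _ (erefl _)).
have [r2 t2] := omega_rational_hodge (Or33 _ _ (erefl _)).
by case: j => [[|[|[|[|[|[|//]]]]]] ?]; apply: cup2_hodge_class.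
Qed.

Lemma sq_basis_BC j : g j \in BC (prodT J J) 2.
Proof.
have [subU _] := vspanP (@hodge_class R _ (prodT J J) 2).
exact: subU (sq_basis_hodge_class j).
Qed.

Lemma omega_sq_free (c : 'I_6 -> C) : \sum_j c j *: g j = 0 -> forall j, c j = 0.
Proof.
have uD : map_mx (ratr : rat -> C) dt \in unitmx by rewrite map_unitmx; case: hdt.
apply: (sq_basis_free_of uD _ (omega1E hdt) (omegaSE hdt) (omega2E hdt)).
by rewrite (polmx_basis hdt) !map_row.
Qed.
End Main.

Theorem proposition5p2 (R : realType) (J : ctorus R 4) (E : 'M[int]_4)
  (hE : principal_polarization J E) (hJ : general J E)
  (n : nat) (hn : (2 <= n)%N)
  (P : line_bundle (prodT J (dualT J))) (hP : normalized_poincare P)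
  (ptJ ptJhat : kform R[i] 4 4)
  (hptJ : point_class J ptJ) (hptJhat : point_class (dualT J) ptJhat)
  (dt : 'M[rat]_4) (hdt : symplectic_basis R dt E) :
  let Cn := cayley_class E P ptJ ptJhat n in
  let w1 := omega1 R dt in
  let w2 := omega2 R dt in
  let ws := omegaS R dt in
  [/\ Cn = n%:R *: (- n%:R *: cup2 ws ws + (2%:R * n%:R ^+ 2) *: cup2 w1 w1
                    + 2%:R *: cup2 w2 w2),
      hodge_class (prodT J J) (p := 2) Cn,
      Cn \in BC (prodT J J) 2 /\
      singular_point (Zlocus (J := J) dt) (vsproj (BC (prodT J J) 2) Cn) &
      forall (K : {vspace 'M[rat]_2}) (ap am : R[i]),
        let vp : 'cV[R[i]]_2 := \col_i (if i == 0 then ap else 1) in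
        let vm : 'cV[R[i]]_2 := \col_i (if i == 0 then am else 1) in
        cartan_eigenbasis ratr K vp vm -> ap * am = n%:R ->
        Cn \in BK dt vp vm /\
        (ap - am) ^+ 2 *: Cn =
          n%:R *: (- (ap * am) *: cup2 (omegaK dt vp vm) (omegaK dt vp vm)
                   + (2%:R * am ^+ 2) *: cup2 (omegaV dt vp) (omegaV dt vp)
                   + (2%:R * ap ^+ 2) *: cup2 (omegaV dt vm) (omegaV dt vm))].
Proof.
move=> Cn w1 w2 ws.
have CnE : Cn = n%:R *: (- n%:R *: cup2 ws ws + (2%:R * n%:R ^+ 2) *: cup2 w1 w1
                    + 2%:R *: cup2 w2 w2).
  apply: cayley_class_of_pullbacks; rewrite /w1 /w2 /ws.
  - by rewrite (omegaSE hdt); exact: (pull_c1 hE hP).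
  - by rewrite (omega1E hdt); exact: (pull_point1 hE hptJ).
  - by rewrite (omega2E hdt); exact: (pull_point2 hE hptJhat).
pose g := sq_basis w1 ws w2; pose BC2 := BC (prodT J J) 2.
have CnS : Cn = \sum_j cayley_coef n%:R j *: g j.
  exact: etrans CnE (cayley_lincomb w1 ws w2 n%:R).
have nz : n%:R != 0 :> R[i] by rewrite pnatr_eq0 -lt0n ltnW.
have [c01 c02 c12] := omega_comm hE hdt.
have gU := sq_basis_BC hE hdt.
have hodgeCn : hodge_class (prodT J J) (p := 2) Cn.
  have h k : hodge_class (prodT J J) (p := 2) (g k) := sq_basis_hodge_class hE hdt k.
  have h11 : hodge_class (prodT J J) (p := 2) (cup2 w1 w1) := h (@Ordinal 6 0 isT).
  have hSS : hodge_class (prodT J J) (p := 2) (cup2 ws ws) := h (@Ordinal 6 3 isT).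
  have h22 : hodge_class (prodT J J) (p := 2) (cup2 w2 w2) := h (@Ordinal 6 5 isT).
  rewrite CnE; apply: (hodge_classZ (p := 2)); first exact: is_ratr_nat.
  apply: (hodge_classD (p := 2)); last exact: (hodge_classZ (is_ratr_nat _ 2) h22).
  apply: (hodge_classD (p := 2));
    [apply: (hodge_classZ _ hSS) | apply: (hodge_classZ _ h11)].
    by exists (- n%:R); rewrite rmorphN rmorph_nat.
  by exists (2%:R * n%:R ^+ 2); rewrite rmorphM rmorphXn !rmorph_nat.
have CnBC : Cn \in BC2.
  have [subU _] := vspanP (@hodge_class R _ (prodT J J) 2).
  exact: subU hodgeCn.
split; [exact: CnE | exact: hodgeCn | |].
- split; first exact: CnBC.
  have -> : vsproj (BC (prodT J J) 2) Cn =
      cayley_point (fun j => vsproj (BC (prodT J J) 2) (g j)) n%:R.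
    by rewrite CnS; exact: vsproj_lincomb.
  rewrite (Zlocus_secant_planes c01 c02 c12 gU).
  apply: cayley_point_singular nz.
  exact: (vsproj_free gU (omega_sq_free hdt)).
move=> K ap am vp vm [_ _ _ uvw _] apam.
have [vp0 vp1] := col2E (erefl vp); have [vm0 vm1] := col2E (erefl vm).
have eqn : (ap - am) ^+ 2 *: Cn =
          n%:R *: (- (ap * am) *: cup2 (omegaK dt vp vm) (omegaK dt vp vm)
                   + (2%:R * am ^+ 2) *: cup2 (omegaV dt vp) (omegaV dt vp)
                   + (2%:R * ap ^+ 2) *: cup2 (omegaV dt vm) (omegaV dt vm)).
  rewrite scale_sum3 CnS -apam.
  apply: (etrans (cayley_in_plane w1 ws w2 ap am)).
  apply: esym; apply: (etrans (BK_lincomb c01 c02 c12 vp vm _ _ _)).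
  by rewrite vp0 vp1 vm0 vm1.
split; last exact: eqn.
have nzd : (ap - am) ^+ 2 != 0.
  move: uvw; rewrite unitmx_cols vp0 vp1 vm0 vm1 mulr1 mul1r => nzd.
  by rewrite expf_neq0.
exact: (memv_add3_of_multiple nzd eqn).
Qed.
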